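(* Let $n\in\mathbb{N}$ and let $a=(a_1,a_2,\dotsc,a_n)$ be real numbers with $0<a_1$ and $a_k\le a_{k+1}$ for $1\le k\le n-1$. For every $z\in\mathbb{C}\setminus(-\infty,-a_1]$, write $a+z=(a_1+z,a_2+z,\dotsc,a_n+z)$. Then the principal branch of the geometric mean $G_n(a+z)=\bigl[\prod_{k=1}^n(a_k+z)\bigr]^{1/n}$ has the integral representation $$G_n(a+z)=A_n(a)+z-\frac1\pi\sum_{\ell=1}^{n-1}\sin\frac{\ell\pi}{n}\int_{a_\ell}^{a_{\ell+1}}\Biggl|\prod_{k=1}^n(a_k-t)\Biggr|^{1/n}\frac{\mathrm{d}t}{t+z}.$$
   Context: $\mathbb{N}$ is the set of positive integers. $A_n(a)=\frac1n\sum_{k=1}^n a_k$ is the arithmetic mean. For $z\in\mathbb{C}\setminus(-\infty,-\min_{1\le k\le n}a_k]$, the principal branch of $G_n(a+z)=\bigl[\prod_{k=1}^n(a_k+z)\bigr]^{1/n}$ means $G_n(a+z)=\exp\Bigl(\frac1n\sum_{k=1}^n\ln(a_k+z)\Bigr)$, where $\ln$ is the principal branch of the logarithm on $\mathbb{C}\setminus(-\infty,0]$, i.e. $\ln w=\ln|w|+i\arg w$ with $\arg w\in(-\pi,\pi)$. An empty sum (the case $n=1$) is $0$. *)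

(* Defs.v *)
From Stdlib Require Export Reals List.
From Stdlib Require Import Lra Psatz.
From Coquelicot Require Export Coquelicot.

Open Scope R_scope.

Definition Cexp (w : C) : C :=
  (exp (Re w) * cos (Im w), exp (Re w) * sin (Im w)).

(* The ray (-oo, x] of the real axis, as a subset of the complex plane. *)
Definition ray_le (x : R) (w : C) : Prop := Im w = 0 /\ Re w <= x.

(* Half-angle formula for the principal argument; it is a uniform expression on
   the slit plane, where |w| + Re w > 0.  [Carg_spec] and [Carg_unique] say that
   this is the argument of w in (-PI, PI).  On the cut the value is
   meaningless. *)
Definition Carg (w : C) : R := 2 * atan (Im w / (Cmod w + Re w)).

Definition Cln (w : C) : C := (ln (Cmod w), Carg w).

(* The n-th root of x >= 0, for n >= 1.  The case split is needed because
   Stdlib has ln 0 = 0, hence Rpower 0 y = 1. *)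
Definition nroot (n : nat) (x : R) : R :=
  if Req_EM_T x 0 then 0 else Rpower x (/ INR n).

(* f m * f (m + 1) * ... * f n, with value 1 if n < m: the multiplicative
   counterpart of [sum_n_m]. *)
Definition prod_n_m (f : nat -> R) (m n : nat) : R :=
  fold_right Rmult 1 (map f (seq m (S n - m))).

(* n-tuples (a_1, ..., a_n) are sequences of which only the entries
   1, ..., n are used. *)
Definition arith_mean (n : nat) (a : nat -> R) : R :=
  / INR n * sum_n_m a 1 n.

Definition geom_mean (n : nat) (w : nat -> C) : C :=
  Cexp (RtoC (/ INR n) * sum_n_m (fun k => Cln (w k)) 1 n)%C.

Lemma slit_pos (w : C) : ~ ray_le 0 w -> 0 < Cmod w + Re w.
Proof.
unfold ray_le; intros H.
assert (H0 := Cmod_ge_0 w).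
assert (H2 := Cmod2_alt w).
destruct (Req_dec (Im w) 0) as [E|E].
- assert (0 < Re w) by (apply Rnot_le_lt; intros L; apply H; split; lra).
  lra.
- assert (0 < Im w ^ 2) by (simpl; nra).
  nra.
Qed.

Lemma Carg_spec (w : C) : ~ ray_le 0 w ->
  - PI < Carg w < PI /\
  w = (Cmod w * cos (Carg w), Cmod w * sin (Carg w)).
Proof.
intros H; apply slit_pos in H.
unfold Carg.
set (u := Cmod w + Re w) in *.
assert (Hm := Cmod_ge_0 w).
assert (Hm2 := Cmod2_alt w).
assert (HM : 0 < Cmod w).
{ destruct Hm as [Hm|Hm]; [exact Hm|]. unfold u in H. nra. }
split.
- destruct (atan_bound (Im w / u)); lra.
- rewrite cos_2a, sin_2a, cos_atan, sin_atan.
  set (v := Im w / u).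
  assert (Hv : Im w = v * u) by (unfold v; field; lra).
  assert (Hr : Re w = u - Cmod w) by (unfold u; ring).
  assert (Hs : 0 < 1 + v²) by (unfold Rsqr; nra).
  assert (Hq : 0 < sqrt (1 + v²)) by (apply sqrt_lt_R0; exact Hs).
  assert (Hqq : sqrt (1 + v²) * sqrt (1 + v²) = 1 + v²)
    by (apply sqrt_sqrt; lra).
  set (q := sqrt (1 + v²)) in *.
  assert (E : Cmod w * 2 = u * (1 + v * v)).
  { apply Rmult_eq_reg_r with u; [|lra]. rewrite Hv, Hr in Hm2. nra. }
  unfold Rsqr in *.
  rewrite (surjective_pairing w) at 1.
  change (fst w) with (Re w); change (snd w) with (Im w).
  assert (E' : Cmod w = u * (q * q) / 2) by (rewrite Hqq; lra).
  f_equal.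
  + transitivity (Cmod w * ((1 - v * v) / (q * q))); [|field; lra].
    rewrite Hr, E', Hqq. field. nra.
  + transitivity (Cmod w * (2 * v / (q * q))); [|field; lra].
    rewrite Hv, E'. field. lra.
Qed.

Lemma Carg_unique (w : C) (t : R) :
  - PI < t < PI -> 0 < Cmod w ->
  w = (Cmod w * cos t, Cmod w * sin t) -> Carg w = t.
Proof.
intros Ht HM E.
assert (Er : Re w = Cmod w * cos t) by (rewrite E at 1; reflexivity).
assert (Ei : Im w = Cmod w * sin t) by (rewrite E at 1; reflexivity).
assert (Hc : 0 < cos (t / 2)) by (apply cos_gt_0; lra).
assert (Et : t = 2 * (t / 2)) by field.
unfold Carg; rewrite Er, Ei, Et, cos_2a_cos, sin_2a.
replace (Cmod w * (2 * sin (t / 2) * cos (t / 2)) /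
         (Cmod w + Cmod w * (2 * cos (t / 2) * cos (t / 2) - 1)))
  with (tan (t / 2)).
- rewrite atan_tan by lra. reflexivity.
- assert (HX : 0 < Cmod w * (2 * cos (t / 2) * cos (t / 2)))
    by (repeat apply Rmult_lt_0_compat; lra).
  unfold tan.
  replace (Cmod w + Cmod w * (2 * cos (t / 2) * cos (t / 2) - 1))
    with (Cmod w * (2 * cos (t / 2) * cos (t / 2))) by ring.
  field. lra.
Qed.

(* Main.v *)
(* The function e(w) = G_n(a+w) - w - A_n(a) is holomorphic in the upper
   half-plane, extends continuously to the real axis, and is O(1/w) at infinity
   (second-order Taylor expansion of s |-> G_n(s a + w)).  Mapping the unit disc
   onto the half-plane with 0 |-> z = x + i y, the mean value property of the
   imaginary parts of e(w) and of (w - x) e(w) expresses Im e(z) and y Re e(z)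
   through Im e on the real axis alone.  At w = -t with a_l <= t <= a_{l+1} the
   arguments of exactly l factors are PI, so there
   Im e = sin(l PI/n) |prod (a_k - t)|^{1/n}, while Im e vanishes outside
   [-a_n, -a_1].  The substitution th = 2 atan ((t + x)/y) turns both mean
   values into the integral against 1/(t+z).  The lower half-plane follows by
   conjugation, and real z > -a_1 by continuity. *)
Require Import Defs.
From Stdlib Require Import Reals List Lra Lia.
From Coquelicot Require Import Coquelicot.
Open Scope R_scope.

(** * Differentiation of complex-valued functions along real curves *)

(** No contour integral or Cauchy theorem is used. Holomorphy enters only as the chain rule along
    real curves, and the mean value property comes from differentiating a circle average in the
    radius: by Cauchy-Riemann the radial derivative is an angular one, which integrates to 0. Only
    imaginary parts are averaged, because [Re e] need not have bounded support on the real axis. The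
    factor [w - x] recovers the real part: it is real on the axis and equals [i y] at [z]. Its
    growth is why decay of order [1/w] matters: [(w - x) e(w)] must stay bounded, since infinity is
    a boundary point of the disc at which no limit is used and boundedness alone makes short arcs
    around it negligible. The other obstacle is the set of points [- a_k], where a factor vanishes
    and its logarithm is lost. The mean is therefore carried in two forms, a product of n-th roots
    (continuous up to the axis) and the exponential of a mean logarithm (differentiable), which
    agree in the open half-plane. Both use an argument that is continuous across the negative axis
    seen from above, where the principal one as defined by [Carg] breaks down. *)

Definition Cderive (f : R -> C) (s : R) (l : C) : Prop :=
  is_derive (fun t => Re (f t)) s (Re l) /\
  is_derive (fun t => Im (f t)) s (Im l).

Lemma C_eq (u v : C) : Re u = Re v -> Im u = Im v -> u = v.
Proof.
destruct u, v; simpl; intros -> ->; reflexivity.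
Qed.

Lemma Cderive_const (c : C) s : Cderive (fun _ => c) s 0%C.
Proof.
split; exact (is_derive_const _ s).
Qed.

Lemma Cderive_plus f g s l m :
  Cderive f s l -> Cderive g s m -> Cderive (fun t => f t + g t)%C s (l + m)%C.
Proof.
intros [F1 F2] [G1 G2]; split;
  [exact (is_derive_plus _ _ _ _ _ F1 G1)|exact (is_derive_plus _ _ _ _ _ F2 G2)].
Qed.

Lemma Cderive_minus f g s l m :
  Cderive f s l -> Cderive g s m -> Cderive (fun t => f t - g t)%C s (l - m)%C.
Proof.
intros [F1 F2] [G1 G2]; split;
  [exact (is_derive_minus _ _ _ _ _ F1 G1)|exact (is_derive_minus _ _ _ _ _ F2 G2)].
Qed.

Lemma Cderive_mult f g s l m :
  Cderive f s l -> Cderive g s m ->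
  Cderive (fun t => f t * g t)%C s (l * g s + f s * m)%C.
Proof.
intros [F1 F2] [G1 G2].
assert (com : forall x y : R_AbsRing, mult x y = mult y x)
  by (intros; apply Rmult_comm).
split.
- refine (eq_rect _ (is_derive _ s)
    (is_derive_minus _ _ _ _ _ (is_derive_mult _ _ _ _ _ F1 G1 com)
                               (is_derive_mult _ _ _ _ _ F2 G2 com)) _ _).
  unfold minus, plus, opp, mult, Re, Im; simpl; ring.
- refine (eq_rect _ (is_derive _ s)
    (is_derive_plus _ _ _ _ _ (is_derive_mult _ _ _ _ _ F1 G2 com)
                              (is_derive_mult _ _ _ _ _ F2 G1 com)) _ _).
  unfold minus, plus, opp, mult, Re, Im; simpl; ring.
Qed.

Lemma Cderive_eq f s l m : Cderive f s l -> l = m -> Cderive f s m.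
Proof. intros H <-; exact H. Qed.

Lemma Derive_at (f : R -> R) (x l : R) :
  is_derive f x l -> Derive (fun t : R => f t) x = l.
Proof. exact (is_derive_unique f x l). Qed.

Lemma Cderive_inv f s l :
  Cderive f s l -> f s <> 0%C -> Cderive (fun t => / f t)%C s (- (l / (f s * f s)))%C.
Proof.
intros [F1 F2] N.
assert (P : 0 < Re (f s) ^ 2 + Im (f s) ^ 2).
{ apply Cmod_gt_0 in N. rewrite <- Cmod2_alt. apply pow_lt, N. }
assert (Q : (Re (f s)*Re (f s)-Im (f s)*Im (f s))^2 +
            (Re (f s) * Im (f s) + Im (f s)*Re (f s))^2 <> 0).
{ replace (_ + _) with ((Re (f s) ^ 2 + Im (f s) ^ 2)^2) by ring. nra. }
set (u := fun t => Re (f t)) in *. set (v := fun t => Im (f t)) in *.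
change (Re (f s)) with (u s) in *; change (Im (f s)) with (v s) in *.
split.
- change (is_derive (fun t => u t / (u t ^ 2 + v t ^ 2)) s (Re (- (l / (f s * f s))))).
  auto_derive; [repeat split; try (eexists; eassumption); simpl in P; lra|].
  rewrite (Derive_at u _ _ F1), (Derive_at v _ _ F2).
  unfold u, v, Re, Im in *; simpl; field; simpl in P; split; simpl in Q; nra.
- change (is_derive (fun t => - v t / (u t ^ 2 + v t ^ 2)) s (Im (- (l / (f s * f s))))).
  auto_derive; [repeat split; try (eexists; eassumption); simpl in P; lra|].
  rewrite (Derive_at u _ _ F1), (Derive_at v _ _ F2).
  unfold u, v, Re, Im in *; simpl; field; simpl in P; split; simpl in Q; nra.
Qed.

Lemma Cderive_exp f s l :
  Cderive f s l -> Cderive (fun t => Cexp (f t)) s (l * Cexp (f s))%C.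
Proof.
intros [F1 F2].
set (u := fun t => Re (f t)) in *. set (v := fun t => Im (f t)) in *.
split.
- change (is_derive (fun t => exp (u t) * cos (v t)) s (Re (l * Cexp (f s)))).
  auto_derive; [repeat split; eexists; eassumption|].
  rewrite (Derive_at u _ _ F1), (Derive_at v _ _ F2).
  unfold u, v, Re, Im; simpl; unfold Re, Im; ring.
- change (is_derive (fun t => exp (u t) * sin (v t)) s (Im (l * Cexp (f s)))).
  auto_derive; [repeat split; eexists; eassumption|].
  rewrite (Derive_at u _ _ F1), (Derive_at v _ _ F2).
  unfold u, v, Re, Im; simpl; unfold Re, Im; ring.
Qed.

Lemma Re_sum_n_m (f : nat -> C) m n :
  Re (sum_n_m f m n) = sum_n_m (fun k => Re (f k)) m n.
Proof.
destruct (Nat.le_gt_cases m n) as [L|L]; [|rewrite !sum_n_m_zero by lia; reflexivity].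
induction L as [|n L IH]; [rewrite !sum_n_n; reflexivity|].
rewrite !sum_n_Sm by lia; rewrite <- IH; reflexivity.
Qed.

Lemma Im_sum_n_m (f : nat -> C) m n :
  Im (sum_n_m f m n) = sum_n_m (fun k => Im (f k)) m n.
Proof.
destruct (Nat.le_gt_cases m n) as [L|L]; [|rewrite !sum_n_m_zero by lia; reflexivity].
induction L as [|n L IH]; [rewrite !sum_n_n; reflexivity|].
rewrite !sum_n_Sm by lia; rewrite <- IH; reflexivity.
Qed.

Lemma is_derive_sum_n_m (f : nat -> R -> R) (l : nat -> R) s m n :
  (forall k, (m <= k <= n)%nat -> is_derive (f k) s (l k)) ->
  is_derive (fun t => sum_n_m (fun k => f k t) m n) s (sum_n_m l m n).
Proof.
destruct (Nat.le_gt_cases m n) as [L|L]; intros H.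
- induction L as [|n L IH].
  + rewrite sum_n_n.
    apply (is_derive_ext (f m)); [intros t; rewrite sum_n_n; reflexivity|apply H; lia].
  + apply (is_derive_ext (fun t => plus (sum_n_m (fun k => f k t) m n) (f (S n) t))).
    { intros t; rewrite sum_n_Sm by lia; reflexivity. }
    rewrite sum_n_Sm by lia.
    refine (is_derive_plus (fun t => sum_n_m (fun k => f k t) m n) (f (S n)) s _ _ (IH _) (H _ _));
      [intros k Hk; apply H; lia|lia].
- rewrite sum_n_m_zero by lia.
  apply (is_derive_ext (fun _ : R_AbsRing => zero : R));
    [intros t; rewrite sum_n_m_zero by lia; reflexivity|].
  exact (is_derive_const _ s).
Qed.

Lemma Cderive_sum (f : nat -> R -> C) (l : nat -> C) s m n :
  (forall k, (m <= k <= n)%nat -> Cderive (f k) s (l k)) ->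
  Cderive (fun t => sum_n_m (fun k => f k t) m n) s (sum_n_m l m n).
Proof.
intros H; split.
- rewrite Re_sum_n_m.
  apply (is_derive_ext (fun t => sum_n_m (fun k => Re (f k t)) m n));
    [intros t; symmetry; apply Re_sum_n_m|].
  apply (is_derive_sum_n_m (fun k t => Re (f k t))); intros k Hk; apply H, Hk.
- rewrite Im_sum_n_m.
  apply (is_derive_ext (fun t => sum_n_m (fun k => Im (f k t)) m n));
    [intros t; symmetry; apply Im_sum_n_m|].
  apply (is_derive_sum_n_m (fun k t => Im (f k t))); intros k Hk; apply H, Hk.
Qed.

(* The argument in [-PI/2, 3PI/2]: unlike [Carg] it is continuous on the whole
   closed upper half-plane minus 0. *)
Definition uarg (w : C) : R := PI / 2 - 2 * atan (Re w / (Cmod w + Im w)).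
Definition ulog (w : C) : C := (ln (Cmod w), uarg w).

Lemma Cmod_plus_Im_pos (w : C) : w <> 0%C -> 0 <= Im w -> 0 < Cmod w + Im w.
Proof. intros N H; apply Cmod_gt_0 in N; lra. Qed.

Lemma Cderive_ulog f s l :
  Cderive f s l -> f s <> 0%C -> 0 <= Im (f s) ->
  Cderive (fun t => ulog (f t)) s (l / f s)%C.
Proof.
intros [F1 F2] N P.
assert (Q := Cmod_plus_Im_pos _ N P).
assert (M := N); apply Cmod_gt_0 in M.
assert (M2 := Cmod2_alt (f s)).
assert (S2 : 0 < Re (f s) ^ 2 + Im (f s) ^ 2) by (rewrite <- M2; nra).
set (u := fun t => Re (f t)) in *. set (v := fun t => Im (f t)) in *.
set (c := fun t => Cmod (f t)).
change (Re (f s)) with (u s) in *; change (Im (f s)) with (v s) in *.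
change (Cmod (f s)) with (c s) in *.
assert (D : is_derive c s ((u s * Re l + v s * Im l) / c s)).
{ apply (is_derive_ext (fun t => sqrt (u t ^ 2 + v t ^ 2))); [reflexivity|].
  auto_derive.
  - repeat split; try (eexists; eassumption).
    simpl in S2; exact S2.
  - rewrite (Derive_at u _ _ F1), (Derive_at v _ _ F2).
    change (sqrt _) with (c s). field. lra. }
split.
- change (is_derive (fun t => ln (c t)) s (Re (l / f s))).
  auto_derive.
  + split; [eexists; exact D|split; [exact M|exact I]].
  + rewrite (Derive_at c _ _ D).
    transitivity ((u s * Re l + v s * Im l) / (u s ^ 2 + v s ^ 2)).
    2: { unfold u, v, Re, Im; simpl; field; simpl in S2; unfold u, v, Re, Im in S2; lra. }
    revert M M2 S2; generalize (c s) (u s) (v s) (Re l) (Im l).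
    intros m x y x' y' M M2 S2.
    transitivity ((x*x'+y*y')/m^2); [field; lra|]. rewrite M2. field. nra.
- change (is_derive (fun t => PI / 2 - 2 * atan (u t / (c t + v t))) s (Im (l / f s))).
  auto_derive.
  + repeat split; try (eexists; eassumption). lra.
  + rewrite (Derive_at c _ _ D), (Derive_at u _ _ F1), (Derive_at v _ _ F2).
    transitivity ((u s * Im l - Re l * v s) / (u s ^ 2 + v s ^ 2)).
    2: { unfold u, v, Re, Im; simpl; field; simpl in S2; unfold u, v, Re, Im in S2; lra. }
    revert M M2 S2 Q; generalize (c s) (u s) (v s) (Re l) (Im l).
    intros m x y x' y' M M2 S2 Q.
    (* The denominator produced by differentiating [atan (x / (m + y))], rewritten with
       [m^2 = x^2 + y^2] so that [m + y] becomes a factor that can cancel. *)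
    assert (K : (m + y)^2 + x^2 = 2 * m * (m + y)) by nra.
    assert (X2 : x ^ 2 = m^2 - y^2) by nra.
    transitivity (- 2 * (x' * (m+y) - x * ((x*x'+y*y')/m + y')) / ((m+y)^2 + x^2)).
    { field. split; [|split]; nra. }
    rewrite K.
    transitivity ((x * y' - x' * y) / m^2); [|rewrite M2; field; nra].
    apply Rminus_diag_uniq.
    transitivity ((x' * ( x^2 - (m^2-y^2))) / (m^2 * (m+y))); [field; lra|].
    rewrite X2; field; lra.
Qed.

(** The point [(Im w, - Re w)] is [- i w], which lies in the right half-plane, and [uarg w] is its
    principal argument plus PI/2. For [0 < Im w] the quotient inside [atan] lies strictly between -1
    and 1, so [uarg w] is in (0, PI) and [Carg_unique] applies. *)
Lemma ulog_Cln (w : C) : 0 < Im w -> ulog w = Cln w.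
Proof.
intros P; unfold ulog, Cln; f_equal; symmetry.
assert (M : 0 < Cmod w) by (apply Cmod_gt_0; intros ->; simpl in P; lra).
assert (M2 := Cmod2_alt w).
apply Carg_unique; [|exact M|].
- unfold uarg.
  assert (B : forall v, - (1) < v < 1 -> - PI/4 < atan v < PI/4).
  { intros v [V1 V2]. apply atan_increasing in V1, V2.
    rewrite atan_opp in V1; rewrite atan_1 in *; lra. }
  assert (B' := B (Re w / (Cmod w + Im w))).
  assert (P0 := PI_RGT_0).
  enough (- PI/4 < atan (Re w / (Cmod w + Im w)) < PI/4) by lra.
  apply B'.
  split; [apply Rlt_div_r|apply Rlt_div_l]; nra.
- assert (Em : Cmod (Im w, - Re w) = Cmod w)
    by (unfold Cmod; simpl; f_equal; unfold Re, Im; ring).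
  assert (E : uarg w = PI/2 + Carg (Im w, - Re w)).
  { unfold Carg, uarg; rewrite Em.
    change (Im (Im w, - Re w)) with (- Re w); change (Re (Im w, - Re w)) with (Im w).
    replace (- Re w / (Cmod w + Im w)) with (-(Re w/(Cmod w + Im w)))
      by (unfold Rdiv; ring).
    rewrite atan_opp; ring. }
  destruct (Carg_spec (Im w, - Re w)) as [_ S].
  { intros [_ H]; change (Im w <= 0) in H; lra. }
  rewrite Em in S; injection S as S1 S2.
  rewrite E, cos_plus, sin_plus, cos_PI2, sin_PI2.
  apply C_eq; cbn [Re Im fst snd]; unfold Re, Im in *; nra.
Qed.

(** * Continuity up to the real axis *)

Lemma continuous_C {T : UniformSpace} (f : T -> C) (x : T) :
  continuous (fun t => Re (f t)) x -> continuous (fun t => Im (f t)) x ->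
  continuous f x.
Proof.
intros H1 H2 P [eps HP].
destruct (H1 _ (locally_ball (Re (f x)) eps)) as [d1 D1].
destruct (H2 _ (locally_ball (Im (f x)) eps)) as [d2 D2].
exists (mkposreal _ (Rmin_stable_in_posreal d1 d2)); intros t Ht; apply HP; split.
- apply D1. apply (ball_le _ (Rmin d1 d2)); [apply Rmin_l|exact Ht].
- apply D2. apply (ball_le _ (Rmin d1 d2)); [apply Rmin_r|exact Ht].
Qed.

Lemma continuous_Re {T : UniformSpace} (f : T -> C) (x : T) :
  continuous f x -> continuous (fun t => Re (f t)) x.
Proof.
intros H; apply (continuous_comp f Re); [exact H|].
destruct (f x) as [u v]; exact (continuous_fst u v).
Qed.

Lemma continuous_Im {T : UniformSpace} (f : T -> C) (x : T) :
  continuous f x -> continuous (fun t => Im (f t)) x.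
Proof.
intros H; apply (continuous_comp f Im); [exact H|].
destruct (f x) as [u v]; exact (continuous_snd u v).
Qed.

Section Continuity.
Context {T : UniformSpace}.
Implicit Types (f g : T -> C) (u v : T -> R) (x : T).

Lemma continuous_Rplus u v x :
  continuous u x -> continuous v x -> continuous (fun t => u t + v t) x.
Proof. intros H K; exact (continuous_plus u v x H K). Qed.

Lemma continuous_Rminus u v x :
  continuous u x -> continuous v x -> continuous (fun t => u t - v t) x.
Proof. intros H K; exact (continuous_minus u v x H K). Qed.

Lemma continuous_Rmult u v x :
  continuous u x -> continuous v x -> continuous (fun t => u t * v t) x.
Proof. intros H K; exact (continuous_mult u v x H K). Qed.

Lemma continuous_Rcomp (h : R -> R) u x :
  continuous u x -> continuity_pt h (u x) -> continuous (fun t => h (u t)) x.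
Proof.
intros H K; apply (continuous_comp u h); [exact H|].
apply continuity_pt_filterlim, K.
Qed.

Lemma continuous_Rsqr u x : continuous u x -> continuous (fun t => u t ^ 2) x.
Proof.
intros H; apply (continuous_Rcomp (fun r => r ^ 2)); [exact H|].
apply derivable_continuous_pt, derivable_pt_pow.
Qed.

Lemma continuous_Rdiv u v x :
  continuous u x -> continuous v x -> v x <> 0 -> continuous (fun t => u t / v t) x.
Proof.
intros H K N; apply continuous_Rmult; [exact H|].
apply (continuous_comp v Rinv); [exact K|apply continuous_Rinv, N].
Qed.

Lemma continuous_Cplus f g x :
  continuous f x -> continuous g x -> continuous (fun t => f t + g t)%C x.
Proof.
intros H K; apply continuous_C; apply continuous_Rplus;
  (apply continuous_Re || apply continuous_Im); assumption.
Qed.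

Lemma continuous_Cminus f g x :
  continuous f x -> continuous g x -> continuous (fun t => f t - g t)%C x.
Proof.
intros H K; apply continuous_C; apply continuous_Rminus;
  (apply continuous_Re || apply continuous_Im); assumption.
Qed.

Lemma continuous_Cmult f g x :
  continuous f x -> continuous g x -> continuous (fun t => f t * g t)%C x.
Proof.
intros H K; apply continuous_C; [apply continuous_Rminus|apply continuous_Rplus];
  apply continuous_Rmult;
  (apply continuous_Re || apply continuous_Im); assumption.
Qed.

Lemma continuous_Cinv f x :
  continuous f x -> f x <> 0%C -> continuous (fun t => / f t)%C x.
Proof.
intros H N.
assert (P : Re (f x) ^ 2 + Im (f x) ^ 2 <> 0).
{ apply Cmod_gt_0 in N. rewrite <- Cmod2_alt. apply pow_nonzero; lra. }
assert (K : continuous (fun t => Re (f t) ^ 2 + Im (f t) ^ 2) x).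
{ apply continuous_Rplus; apply continuous_Rsqr;
    (apply continuous_Re || apply continuous_Im); assumption. }
apply continuous_C; apply continuous_Rdiv; try assumption.
- apply continuous_Re, H.
- apply (continuous_opp (fun t => Im (f t))), continuous_Im, H.
Qed.

Lemma continuous_Cexp f x : continuous f x -> continuous (fun t => Cexp (f t)) x.
Proof.
intros H; assert (H1 := continuous_Re _ _ H); assert (H2 := continuous_Im _ _ H).
apply continuous_C; apply continuous_Rmult;
  [apply (continuous_Rcomp exp)|apply (continuous_Rcomp cos)
  |apply (continuous_Rcomp exp)|apply (continuous_Rcomp sin)]; try assumption;
  apply derivable_continuous_pt;
  (apply derivable_pt_exp || apply derivable_pt_cos || apply derivable_pt_sin).
Qed.

Lemma continuous_Cmod f x : continuous f x -> continuous (fun t => Cmod (f t)) x.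
Proof.
intros H; apply (continuous_comp _ sqrt); [|apply continuous_sqrt].
apply continuous_Rplus; apply continuous_Rsqr;
  (apply continuous_Re || apply continuous_Im); assumption.
Qed.

Lemma continuous_ulog f x :
  continuous f x -> f x <> 0%C -> 0 <= Im (f x) -> continuous (fun t => ulog (f t)) x.
Proof.
intros H N P.
assert (K := continuous_Cmod _ _ H).
assert (M := N); apply Cmod_gt_0 in M.
assert (Q := Cmod_plus_Im_pos _ N P).
apply continuous_C; simpl.
- apply (continuous_comp _ ln); [exact K|apply continuous_ln, M].
- unfold uarg; apply continuous_Rminus; [apply continuous_const|].
  apply continuous_Rmult; [apply continuous_const|].
  apply (continuous_comp _ atan); [|apply continuous_atan].
  apply continuous_Rdiv; [apply continuous_Re, H| |lra].
  apply continuous_Rplus; [exact K|apply continuous_Im, H].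
Qed.

Lemma continuous_Csum (h : nat -> T -> C) m n x :
  (forall k, (m <= k <= n)%nat -> continuous (h k) x) ->
  continuous (fun t => sum_n_m (fun k => h k t) m n) x.
Proof.
destruct (Nat.le_gt_cases m n) as [L|L]; intros H.
- induction L as [|n L IH].
  + apply (continuous_ext (h m)); [intros t; rewrite sum_n_n; reflexivity|apply H; lia].
  + apply (continuous_ext (fun t => (sum_n_m (fun k => h k t) m n + h (S n) t)%C)).
    { intros t; rewrite sum_n_Sm by lia; reflexivity. }
    apply continuous_Cplus; [apply IH; intros k Hk; apply H; lia|apply H; lia].
- apply (continuous_ext (fun _ : T => zero : C)); [intros t; rewrite sum_n_m_zero by lia; reflexivity|].
  apply continuous_const.
Qed.
End Continuity.

(** * Roots and geometric means on the closed upper half-plane *)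

Lemma Cexp_plus (u v : C) : Cexp (u + v) = (Cexp u * Cexp v)%C.
Proof.
unfold Cexp; apply C_eq; cbn [Re Im fst snd Cplus Cmult]; rewrite exp_plus, ?cos_plus, ?sin_plus;
  unfold Re, Im; ring.
Qed.

Lemma Cmod_Cexp (w : C) : Cmod (Cexp w) = exp (Re w).
Proof.
unfold Cmod; simpl.
replace (_ + _) with ((exp (Re w))²).
- apply sqrt_Rsqr, Rlt_le, exp_pos.
- assert (E := sin2_cos2 (Im w)); unfold Rsqr in *.
  transitivity (exp (Re w) * exp (Re w) * (sin (Im w) * sin (Im w) + cos (Im w) * cos (Im w)));
    [rewrite E; ring|ring].
Qed.

(** The value at 0 is set by hand: [ln 0 = 0] would give a root of modulus 1 there, whereas
    continuity at 0 is what makes the boundary points [- a_k] harmless. *)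
Definition uroot (n : nat) (w : C) : C :=
  if Req_EM_T (Cmod w) 0 then 0%C else Cexp (RtoC (/ INR n) * ulog w)%C.

Lemma Cmod_uroot n (w : C) : Cmod (uroot n w) = nroot n (Cmod w).
Proof.
unfold uroot, nroot; destruct (Req_EM_T (Cmod w) 0) as [E|E].
- apply Cmod_0.
- rewrite Cmod_Cexp; unfold Rpower; simpl; f_equal; ring.
Qed.

Lemma nroot_lt n (x eps : R) :
  (1 <= n)%nat -> 0 <= x -> 0 < eps -> x < Rpower eps (INR n) -> nroot n x < eps.
Proof.
intros Hn Hx He H; unfold nroot; destruct (Req_EM_T x 0) as [E|E]; [exact He|].
assert (N : 0 < INR n) by (apply lt_0_INR; lia).
rewrite <- (Rpower_1 eps) by exact He.
rewrite <- (Rinv_r (INR n)) by lra.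
rewrite <- Rpower_mult.
apply Rlt_Rpower_l; [apply Rinv_0_lt_compat, N|lra].
Qed.

Lemma continuous_uroot n (w : C) : (1 <= n)%nat -> 0 <= Im w -> continuous (uroot n) w.
Proof.
intros Hn P.
destruct (Req_dec (Cmod w) 0) as [E|E].
- apply Cmod_eq_0 in E; subst w.
  intros Q [eps HQ].
  (* Balls of [C] are squares, so a radius [d] bounds the modulus only by [sqrt 2 * d]; halving
     absorbs the factor [sqrt 2 < 2]. *)
  assert (D : 0 < Rpower eps (INR n) / 2) by (apply Rdiv_lt_0_compat; [apply exp_pos|lra]).
  exists (mkposreal _ D); intros v Hv; apply HQ.
  assert (U0 : uroot n 0%C = 0%C).
  { unfold uroot; destruct (Req_EM_T (Cmod 0) 0) as [_|N]; [reflexivity|].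
    destruct N; apply Cmod_0. }
  rewrite U0.
  apply C_NormedModule_mixin_compat1.
  change (Cmod (uroot n v - RtoC 0)%C < eps).
  replace (uroot n v - RtoC 0)%C with (uroot n v) by ring.
  rewrite Cmod_uroot.
  apply nroot_lt; [exact Hn|apply Cmod_ge_0|apply eps|].
  replace v with (v - RtoC 0)%C by ring.
  eapply Rlt_trans; [exact (C_NormedModule_mixin_compat2 _ _ _ Hv)|].
  simpl. assert (sqrt 2 < 2). { rewrite <- (sqrt_Rsqr 2) at 2 by lra. apply sqrt_lt_1; unfold Rsqr; lra. }
  nra.
- assert (N : w <> 0%C) by (intros ->; apply E, Cmod_0).
  apply (continuous_ext_loc _ (fun v => Cexp (RtoC (/ INR n) * ulog v)%C)).
  + assert (K : locally w (fun v => 0 < Cmod v)).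
    { apply (continuous_Cmod (fun v : C_UniformSpace => v) w (continuous_id w)).
      apply (open_gt 0); apply Cmod_gt_0, N. }
    revert K; apply filter_imp; intros v Hv.
    unfold uroot; destruct (Req_EM_T (Cmod v) 0); [lra|reflexivity].
  + apply continuous_Cexp, continuous_Cmult; [apply continuous_const|].
    apply (continuous_ulog (fun v : C_UniformSpace => v)); [apply continuous_id|exact N|exact P].
Qed.

Fixpoint Cprod (f : nat -> C) (n : nat) : C :=
  match n with 0%nat => 1%C | S m => (Cprod f m * f (S m))%C end.

(** Roots are taken factor by factor: the arguments then add up without wrapping around, and a
    vanishing factor simply makes the product 0 continuously. *)
Definition umean (n : nat) (a : nat -> R) (w : C) : C :=
  Cprod (fun k => uroot n (RtoC (a k) + w)%C) n.

Lemma Cprod_ext f g n :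
  (forall k, (1 <= k <= n)%nat -> f k = g k) -> Cprod f n = Cprod g n.
Proof.
induction n as [|n IH]; intros H; [reflexivity|]; simpl.
rewrite IH, H; [reflexivity|lia|intros k Hk; apply H; lia].
Qed.

Lemma Cprod_Cexp (c : C) f n :
  Cprod (fun k => Cexp (c * f k)%C) n = Cexp (c * sum_n_m f 1 n)%C.
Proof.
induction n as [|n IH].
- rewrite sum_n_m_zero by lia. unfold Cexp; apply C_eq; simpl;
  rewrite !Rmult_0_r, Rminus_0_r, Rplus_0_r, exp_0, ?cos_0, ?sin_0; ring.
- rewrite sum_n_Sm by lia; simpl; rewrite IH.
  change (plus ?x ?y) with (x + y)%C.
  rewrite Cmult_plus_distr_l, Cexp_plus; reflexivity.
Qed.

Lemma umean_exp n a (w : C) : 0 < Im w ->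
  umean n a w = Cexp (RtoC (/ INR n) * sum_n_m (fun k => ulog (RtoC (a k) + w)%C) 1 n)%C.
Proof.
intros P; unfold umean; rewrite <- Cprod_Cexp; apply Cprod_ext; intros k _.
unfold uroot; destruct (Req_EM_T _ 0) as [E|E]; [|reflexivity].
apply Cmod_eq_0 in E; apply (f_equal Im) in E; simpl in E; unfold Im in P; lra.
Qed.

Lemma umean_geom_mean n a (w : C) : 0 < Im w ->
  umean n a w = geom_mean n (fun k => RtoC (a k) + w)%C.
Proof.
intros P; rewrite umean_exp by exact P; unfold geom_mean; do 2 f_equal.
apply sum_n_m_ext; intros k; apply ulog_Cln; simpl; unfold Im in P; lra.
Qed.

Lemma continuous_Cprod {T : UniformSpace} (f : nat -> T -> C) n x :
  (forall k, (1 <= k <= n)%nat -> continuous (f k) x) ->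
  continuous (fun t => Cprod (fun k => f k t) n) x.
Proof.
induction n as [|n IH]; intros H; simpl; [apply continuous_const|].
apply continuous_Cmult; [apply IH; intros k Hk; apply H; lia|apply H; lia].
Qed.

(** Folding the plane onto the closed upper half-plane turns continuity from above at a real point
    into the two-sided [continuous]. *)
Definition reflect (w : C) : C := (Re w, Rabs (Im w)).

Lemma continuous_reflect (w : C) : continuous reflect w.
Proof.
apply continuous_C; simpl.
- apply (continuous_Re (fun v : C_UniformSpace => v)), continuous_id.
- apply (continuous_comp _ Rabs); [|apply continuous_Rabs].
  apply (continuous_Im (fun v : C_UniformSpace => v)), continuous_id.
Qed.

Lemma reflect_id (w : C) : 0 <= Im w -> reflect w = w.
Proof. intros P; apply C_eq; simpl; [reflexivity|apply Rabs_pos_eq, P]. Qed.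

Lemma continuous_umean_reflect n a (w : C) :
  (1 <= n)%nat -> continuous (fun v => umean n a (reflect v)) w.
Proof.
intros Hn; unfold umean.
apply (continuous_Cprod (fun k v => uroot n (RtoC (a k) + reflect v)%C)); intros k _.
apply (continuous_comp (fun v => RtoC (a k) + reflect v)%C (uroot n)).
- apply continuous_Cplus; [apply continuous_const|apply continuous_reflect].
- apply continuous_uroot; [exact Hn|simpl; rewrite Rplus_0_l; apply Rabs_pos].
Qed.

(** * Mean value property on the disc *)

(** This is [|1 + u|^2] for [u = r exp(- i th)]. The minus sign in the angle makes the boundary
    parameter increase with [t] when the boundary point is [- t]. *)
Definition disc_den (r th : R) : R := 1 + 2 * r * cos th + r ^ 2.

(* [x + i y (1 - u) / (1 + u)] at [u = r exp (- i th)]: a conformal map of the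
   unit disc onto the upper half-plane sending 0 to [x + i y]. *)
Definition disc_map (x y r th : R) : C :=
  (x - 2 * y * r * sin th / disc_den r th, y * (1 - r ^ 2) / disc_den r th).

(** The complex number [- 2 i y exp(- i th) / (1 + u)^2] with [u = r exp(- i th)], in real
    coordinates. *)
Definition disc_map_dr (y r th : R) : C :=
  (- 2 * y * sin th * (1 - r ^ 2) / disc_den r th ^ 2,
   - 2 * y * (2 * r + cos th * (1 + r ^ 2)) / disc_den r th ^ 2).

Lemma disc_den_pos r th : -1 < r < 1 -> 0 < disc_den r th.
Proof.
intros H; unfold disc_den.
destruct (COS_bound th) as [C1 C2].
replace (1 + 2 * r * cos th + r ^ 2) with ((1 + r * cos th)^2 + r^2 * (1 - (cos th)^2)) by ring.
assert (0 < 1 + r * cos th) by (destruct (Rle_dec 0 r); nra).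
assert (0 <= r^2 * (1 - (cos th)^2)) by (apply Rmult_le_pos; nra).
nra.
Qed.

Lemma disc_den_1_pos th : - PI < th < PI -> 0 < disc_den 1 th.
Proof.
intros H; unfold disc_den.
assert (0 < cos (th / 2)) by (apply cos_gt_0; lra).
replace th with (2 * (th / 2)) by field.
rewrite cos_2a_cos; nra.
Qed.

Lemma disc_map_Im_pos x y r th : 0 < y -> -1 < r < 1 -> 0 < Im (disc_map x y r th).
Proof.
intros Hy Hr; simpl; apply Rdiv_lt_0_compat; [|apply disc_den_pos, Hr].
apply Rmult_lt_0_compat; nra.
Qed.

Lemma Cderive_disc_map_r x y r th : disc_den r th <> 0 ->
  Cderive (fun r => disc_map x y r th) r (disc_map_dr y r th).
Proof.
unfold disc_map, disc_map_dr, disc_den; intros H.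
split; simpl; auto_derive; try exact H; (field; intros E; apply H; rewrite <- E; ring).
Qed.

(* Cauchy-Riemann in polar coordinates: d/dth = - i r d/dr. *)
Lemma Cderive_disc_map_th x y r th : disc_den r th <> 0 ->
  Cderive (fun th => disc_map x y r th) th (- Ci * RtoC r * disc_map_dr y r th)%C.
Proof.
unfold disc_map, disc_map_dr, disc_den; intros H.
assert (S2 : sin th ^ 2 = 1 - cos th ^ 2)
  by (assert (E := sin2_cos2 th); unfold Rsqr in E; lra).
split; simpl; auto_derive; try exact H.
- transitivity (-2 * y * r * (cos th * (1 + 2 * r * cos th + r ^ 2) + 2 * r * sin th ^ 2) /
    (1 + 2 * r * cos th + r ^ 2) ^ 2);
    [|rewrite S2]; field; intros E; apply H; rewrite <- E; ring.
- field; intros E; apply H; rewrite <- E; ring.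
Qed.

Lemma continuous_disc_den (p : R * R) :
  continuous (fun q : R * R => disc_den (fst q) (snd q)) p.
Proof.
unfold disc_den; destruct p as [r th].
assert (F := continuous_fst (U := R_UniformSpace) (V := R_UniformSpace) r th).
assert (S := continuous_snd (U := R_UniformSpace) (V := R_UniformSpace) r th).
apply continuous_Rplus; [apply continuous_Rplus|].
- apply continuous_const.
- apply continuous_Rmult; [apply continuous_Rmult; [apply continuous_const|exact F]|].
  apply (continuous_Rcomp cos); [exact S|apply continuity_cos].
- apply continuous_Rsqr, F.
Qed.

Lemma continuous_disc_map x y (p : R * R) : disc_den (fst p) (snd p) <> 0 ->
  continuous (fun q : R * R => disc_map x y (fst q) (snd q)) p.
Proof.
intros N; assert (D := continuous_disc_den p); destruct p as [r th].
assert (F := continuous_fst (U := R_UniformSpace) (V := R_UniformSpace) r th).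
assert (S := continuous_snd (U := R_UniformSpace) (V := R_UniformSpace) r th).
assert (S' : continuous (fun q : R * R => sin (snd q)) (r, th))
  by (apply (continuous_Rcomp sin); [exact S|apply continuity_sin]).
apply continuous_C; simpl.
- apply continuous_Rminus; [apply continuous_const|].
  apply continuous_Rdiv; [|exact D|exact N].
  repeat (apply continuous_Rmult || apply continuous_const || assumption).
- apply continuous_Rdiv; [|exact D|exact N].
  apply continuous_Rmult; [apply continuous_const|].
  apply continuous_Rminus; [apply continuous_const|apply (continuous_Rsqr fst), F].
Qed.

Lemma continuous_disc_map_dr y (p : R * R) : disc_den (fst p) (snd p) <> 0 ->
  continuous (fun q : R * R => disc_map_dr y (fst q) (snd q)) p.
Proof.
intros N; assert (D := continuous_disc_den p); destruct p as [r th].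
assert (F := continuous_fst (U := R_UniformSpace) (V := R_UniformSpace) r th).
assert (S := continuous_snd (U := R_UniformSpace) (V := R_UniformSpace) r th).
assert (S' : continuous (fun q : R * R => sin (snd q)) (r, th))
  by (apply (continuous_Rcomp sin); [exact S|apply continuity_sin]).
assert (C' : continuous (fun q : R * R => cos (snd q)) (r, th))
  by (apply (continuous_Rcomp cos); [exact S|apply continuity_cos]).
assert (F2 := continuous_Rsqr fst _ F).
assert (D2 := continuous_Rsqr _ _ D).
assert (N2 : disc_den (fst (r, th)) (snd (r, th)) ^ 2 <> 0) by (apply pow_nonzero, N).
apply continuous_C; unfold disc_map_dr, Re, Im; cbn [fst snd];
  (apply continuous_Rdiv; [|exact D2|exact N2]);
  repeat (apply continuous_Rmult || apply continuous_Rminus || apply continuous_Rplus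
          || apply continuous_const || assumption).
Qed.

Lemma RInt_param_close (f : R -> R -> R) (a b c eps : R) : a <= b -> 0 < eps ->
  (forall t, a <= t <= b -> continuity_2d_pt f t c) ->
  ex_RInt (fun t => f t c) a b ->
  exists d, 0 < d /\ forall s, Rabs (s - c) <= d -> ex_RInt (fun t => f t s) a b ->
    Rabs (RInt (fun t => f t s) a b - RInt (fun t => f t c) a b) <= eps.
Proof.
intros Hab Heps Hf Ec.
(* The [+ 1] keeps the tolerance well defined when [a = b]. *)
destruct (uniform_continuity_2d_1d f a b c Hf
  (mkposreal (eps / (b - a + 1)) ltac:(apply Rdiv_lt_0_compat; lra))) as [d Hd].
assert (d_pos := cond_pos d).
exists (d / 2); split; [lra|]; intros s Hs Es.
assert (E : RInt (fun t => f t s) a b - RInt (fun t => f t c) a b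
            = RInt (fun t => f t s - f t c) a b)
  by (symmetry; exact (RInt_minus (fun t => f t s) (fun t => f t c) a b Es Ec)).
rewrite E; eapply Rle_trans; [apply (abs_RInt_le_const _ _ _ (eps / (b - a + 1)) Hab)|].
- exact (ex_RInt_minus _ _ _ _ Es Ec).
- intros t Ht; left.
  assert (Hs' := Rabs_le_between (s - c) (d / 2)).
  apply (Hd t c t s); try lra.
  rewrite Rminus_diag, Rabs_R0; exact d_pos.
- apply Rmult_le_reg_r with (b - a + 1); [lra|].
  replace (_ * _ * _) with ((b - a) * eps) by (field; lra). nra.
Qed.

Lemma continuous_section (f : R * R -> R) (r th : R) :
  continuous f (r, th) -> continuous (fun t => f (r, t)) th.
Proof.
intros H; apply (continuous_comp (fun t => (r, t)) f); [|exact H].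
intros P [eps HP]; exists eps; intros t Ht; apply HP; split; [apply ball_center|exact Ht].
Qed.

Section MeanValue.
Variables (F F' : C -> C) (x y M : R).
Hypothesis y_pos : 0 < y.
Hypothesis F_cont : forall w, continuous F w.
Hypothesis F'_cont : forall w, 0 < Im w -> continuous F' w.
(* Holomorphy, as the chain rule along arbitrary curves. *)
Hypothesis F_derive : forall (c : R -> C) (s : R) (l : C),
  Cderive c s l -> 0 < Im (c s) -> Cderive (fun t => F (c t)) s (l * F' (c s))%C.
Hypothesis F_bound : forall w, 0 < Im w -> Rabs (Im (F w)) <= M.

Let V (r th : R) : R := Im (F (disc_map x y r th)).
Let V' (r th : R) : R := Im (disc_map_dr y r th * F' (disc_map x y r th))%C.

Lemma continuous_pullback r th : disc_den r th <> 0 ->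
  continuous (fun q : R * R => V (fst q) (snd q)) (r, th).
Proof.
intros N; apply continuous_Im.
apply (continuous_comp (fun q : R * R => disc_map x y (fst q) (snd q)) F);
  [apply (continuous_disc_map x y (r, th)), N|apply F_cont].
Qed.

Lemma continuous_pullback_dr r th : -1 < r < 1 ->
  continuous (fun q : R * R => V' (fst q) (snd q)) (r, th).
Proof.
intros Hr; assert (N := disc_den_pos r th Hr); apply continuous_Im.
apply continuous_Cmult; [apply (continuous_disc_map_dr y (r, th)); simpl; lra|].
apply (continuous_comp (fun q : R * R => disc_map x y (fst q) (snd q)) F').
- apply (continuous_disc_map x y (r, th)); simpl; lra.
- apply F'_cont, disc_map_Im_pos; assumption.
Qed.

Lemma ex_RInt_pullback r a b :
  (forall th, Rmin a b <= th <= Rmax a b -> disc_den r th <> 0) -> ex_RInt (V r) a b.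
Proof.
intros H; apply (ex_RInt_continuous (V := R_CompleteNormedModule)); intros th Hth.
apply (continuous_section (fun q => V (fst q) (snd q))), continuous_pullback, H, Hth.
Qed.

Lemma is_derive_pullback r th : -1 < r < 1 -> is_derive (fun u => V u th) r (V' r th).
Proof.
intros Hr; apply (F_derive (fun u => disc_map x y u th)).
- apply Cderive_disc_map_r; assert (N := disc_den_pos r th Hr); lra.
- apply disc_map_Im_pos; assumption.
Qed.

(* The radial derivative is an angular derivative, so it integrates to 0 over a
   full circle. *)
Lemma RInt_pullback_dr r : 0 < r < 1 -> RInt (V' r) (- PI) PI = 0.
Proof.
intros Hr.
(* Since [Re (- i v) = Im v], the angular derivative of [Re F] is [r] times the radial derivative of
   [Im F]; dividing by [r] gives a primitive of [V' r]. *)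
set (U := fun th => / r * Re (F (disc_map x y r th))).
assert (HU : forall th, is_derive U th (V' r th)).
{ intros th; unfold U, V'.
  assert (K := F_derive (fun t => disc_map x y r t) th _ (Cderive_disc_map_th x y r th
     ltac:(assert (N := disc_den_pos r th ltac:(lra)); lra))
     (disc_map_Im_pos x y r th y_pos ltac:(lra))).
  refine (eq_rect _ (is_derive _ th) (is_derive_scal _ th (/ r) _ (proj1 K)) _ _).
  generalize (disc_map_dr y r th) (F' (disc_map x y r th)); intros [d1 d2] [e1 e2].
  simpl; field; lra. }
assert (C : forall th, continuous (V' r) th).
{ intros th; apply (continuous_section (fun q => V' (fst q) (snd q))), continuous_pullback_dr; lra. }
rewrite (is_RInt_unique _ _ _ _ (is_RInt_derive U (V' r) (- PI) PI
   (fun th _ => HU th) (fun th _ => C th))).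
unfold U, minus, plus, opp; simpl.
assert (E : disc_map x y r PI = disc_map x y r (- PI)).
{ unfold disc_map, disc_den; rewrite cos_neg, sin_neg, sin_PI; f_equal; unfold Rdiv; ring. }
rewrite E; ring.
Qed.

(** Differentiation under the integral sign. Radii range over (-1, 1), where [disc_den] is positive,
    so that [r = 0] also has a two-sided neighbourhood. *)
Lemma is_derive_RInt_pullback r : -1 < r < 1 ->
  is_derive (fun u => RInt (V u) (- PI) PI) r (RInt (fun th => Derive (fun u => V u th) r) (- PI) PI).
Proof.
intros Hr.
assert (L : locally r (fun u => -1 < u < 1)).
{ apply (open_and (fun u => -1 < u) (fun u => u < 1)); [apply open_gt|apply open_lt|exact Hr]. }
apply is_derive_RInt_param.
- revert L; apply filter_imp; intros u Hu th _; eexists; apply is_derive_pullback, Hu.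
- intros th _; apply continuity_2d_pt_filterlim.
  change (continuous (fun q : R * R => Derive (fun z => V z (snd q)) (fst q)) (r, th)).
  apply (continuous_ext_loc _ (fun q : R * R => V' (fst q) (snd q)));
    [|apply continuous_pullback_dr, Hr].
  destruct L as [eps L]; exists eps; intros [u t] [Hu _]; simpl.
  symmetry; apply is_derive_unique, is_derive_pullback, L, Hu.
- revert L; apply filter_imp; intros u Hu; apply ex_RInt_pullback.
  intros th _; assert (N := disc_den_pos u th Hu); lra.
Qed.

(** The circle integral has derivative 0 in the radius, so it keeps its value at [r = 0], where
    [disc_map] is constantly [x + i y]. *)
Lemma disc_mean_value r : 0 <= r < 1 -> RInt (V r) (- PI) PI = 2 * PI * Im (F (x, y)).
Proof.
intros Hr.
assert (E0 : RInt (V 0) (- PI) PI = 2 * PI * Im (F (x, y))).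
{ rewrite (RInt_ext _ (fun _ => Im (F (x, y)))).
  - rewrite RInt_const; unfold scal; simpl; unfold mult; simpl; ring.
  - intros th _; unfold V; do 2 f_equal.
    unfold disc_map, disc_den; f_equal; field; nra. }
rewrite <- E0.
destruct (Req_dec r 0) as [->|N]; [reflexivity|].
destruct (MVT_gen (fun u => RInt (V u) (- PI) PI) 0 r (fun _ => 0)) as [c [_ Hc]].
- rewrite Rmin_left, Rmax_right by lra; intros u Hu.
  assert (K := is_derive_RInt_pullback u ltac:(lra)).
  rewrite (RInt_ext _ (V' u)), RInt_pullback_dr in K; [exact K|lra|].
  intros th _; apply is_derive_unique, is_derive_pullback; lra.
- rewrite Rmin_left, Rmax_right by lra; intros u Hu.
  apply continuity_pt_filterlim, (ex_derive_continuous (fun u => RInt (V u) (- PI) PI)).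
  eexists; apply is_derive_RInt_pullback; lra.
- simpl in Hc; lra.
Qed.

(* [M] controls the two arcs near [th = PI] and [th = - PI], where the boundary
   value at infinity is not assumed to exist. *)
Lemma boundary_mean_value al be : - PI < al -> al <= be -> be < PI ->
  Rabs (RInt (V 1) al be - 2 * PI * Im (F (x, y))) <= M * ((al + PI) + (PI - be)).
Proof.
intros H1 H2 H3.
assert (NZ : forall r th, 0 <= r < 1 -> disc_den r th <> 0)
  by (intros r th Hr; assert (N := disc_den_pos r th ltac:(lra)); lra).
assert (EX : forall r a b, 0 <= r < 1 -> ex_RInt (V r) a b)
  by (intros r a b Hr; apply ex_RInt_pullback; intros th _; apply NZ, Hr).
assert (EX1 : ex_RInt (V 1) al be).
{ apply ex_RInt_pullback; rewrite Rmin_left, Rmax_right by lra; intros th Hth.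
  assert (N := disc_den_1_pos th ltac:(lra)); lra. }
(* Inside the disc the full circle integral is exact, and the error is the integral over the two
   omitted arcs. *)
assert (B : forall r, 0 <= r < 1 ->
  Rabs (RInt (V r) al be - 2 * PI * Im (F (x, y))) <= M * ((al + PI) + (PI - be))).
{ intros r Hr; rewrite <- (disc_mean_value r Hr).
  rewrite <- (RInt_Chasles (V r) (- PI) al PI), <- (RInt_Chasles (V r) al be PI)
    by (apply EX, Hr).
  assert (b : forall a b, a <= b -> Rabs (RInt (V r) a b) <= (b - a) * M).
  { intros a b Hab; apply abs_RInt_le_const; [exact Hab|apply EX, Hr|].
    intros th _; apply F_bound, disc_map_Im_pos; [exact y_pos|lra]. }
  assert (b1 := b (- PI) al ltac:(lra)); assert (b2 := b be PI ltac:(lra)).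
  unfold plus; simpl.
  replace (_ - _) with (- (RInt (V r) (- PI) al + RInt (V r) be PI)) by ring.
  rewrite Rabs_Ropp; eapply Rle_trans; [apply Rabs_triang|lra]. }
apply le_epsilon; intros eps Heps.
(* The arc from [al] to [be] avoids the preimage of infinity, so the integrand is jointly continuous
   up to [r = 1] and the bound survives the limit. *)
destruct (RInt_param_close (fun th r => V r th) al be 1 eps H2 Heps) as [d [d_pos Hd]];
  [|exact EX1|].
{ intros th Hth; apply continuity_2d_pt_filterlim.
  assert (N := disc_den_1_pos th ltac:(lra)).
  apply (continuous_comp (fun q : R * R => (snd q, fst q)) (fun q => V (fst q) (snd q)) (th, 1)).
  - intros P [e HP]; exists e; intros [u v] [Hu Hv]; apply HP; split; assumption.
  - apply continuous_pullback; simpl; lra. }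
(* The cap [1 / 2] keeps [r] nonnegative however large [d] is. *)
set (r := 1 - Rmin d (1 / 2)).
assert (Hm : 0 < Rmin d (1 / 2)) by (apply Rmin_pos; lra).
assert (Hl := Rmin_l d (1 / 2)); assert (Hr := Rmin_r d (1 / 2)).
assert (r01 : 0 <= r < 1) by (unfold r; lra).
assert (rd : Rabs (r - 1) <= d) by (unfold r; apply Rabs_le; split; lra).
assert (K : Rabs (RInt (V 1) al be - RInt (V r) al be) <= eps)
  by (rewrite Rabs_minus_sym; exact (Hd r rd (EX r al be r01))).
specialize (B r r01).
replace (_ - _) with ((RInt (V 1) al be - RInt (V r) al be) +
  (RInt (V r) al be - 2 * PI * Im (F (x, y)))) by ring.
eapply Rle_trans; [apply Rabs_triang|lra].
Qed.
End MeanValue.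

(** * Behaviour of the geometric mean at infinity *)

(** The differentiable form of the mean. It takes an arbitrary tuple, so that it can be
    differentiated both in [w] and along [s a + w]. *)
Definition log_mean (n : nat) (c : nat -> C) : C :=
  Cexp (RtoC (/ INR n) * sum_n_m (fun k => ulog (c k)) 1 n)%C.

Definition Cmean (n : nat) (c : nat -> C) : C :=
  (RtoC (/ INR n) * sum_n_m c 1 n)%C.

Lemma Cderive_log_mean n (c : nat -> R -> C) (l : nat -> C) s :
  (forall k, (1 <= k <= n)%nat -> Cderive (c k) s (l k)) ->
  (forall k, (1 <= k <= n)%nat -> 0 < Im (c k s)) ->
  Cderive (fun t => log_mean n (fun k => c k t)) s
    (Cmean n (fun k => l k / c k s)%C * log_mean n (fun k => c k s))%C.
Proof.
intros H P; unfold log_mean, Cmean.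
apply Cderive_exp.
eapply Cderive_eq.
- apply Cderive_mult; [apply Cderive_const|].
  apply (Cderive_sum (fun k t => ulog (c k t))); intros k Hk.
  apply Cderive_ulog; [apply H, Hk| |apply Rlt_le, P, Hk].
  intros E; assert (Q := P k Hk); rewrite E in Q; simpl in Q; lra.
- simpl; ring.
Qed.

Lemma Cmod_sum_le n (f : nat -> C) M :
  (forall k, (1 <= k <= n)%nat -> Cmod (f k) <= M) -> Cmod (sum_n_m f 1 n) <= INR n * M.
Proof.
induction n as [|n IH]; intros H.
- rewrite sum_n_m_zero by lia; change (Cmod (RtoC 0) <= INR 0 * M).
  rewrite Cmod_0; simpl; lra.
- rewrite sum_n_Sm by lia; eapply Rle_trans; [apply Cmod_triangle|].
  rewrite S_INR, Rmult_plus_distr_r, Rmult_1_l.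
  apply Rplus_le_compat; [apply IH; intros k Hk; apply H; lia|apply H; lia].
Qed.

Lemma Cmod_mean_le n (f : nat -> C) M : (1 <= n)%nat ->
  (forall k, (1 <= k <= n)%nat -> Cmod (f k) <= M) -> Cmod (Cmean n f) <= M.
Proof.
intros Hn H; unfold Cmean.
assert (N : 0 < INR n) by (apply lt_0_INR; lia).
rewrite Cmod_mult, Cmod_R, Rabs_pos_eq by (apply Rlt_le, Rinv_0_lt_compat, N).
apply Rmult_le_reg_l with (INR n); [exact N|].
rewrite <- Rmult_assoc, Rinv_r, Rmult_1_l by lra.
apply Cmod_sum_le, H.
Qed.

Lemma sum_n_m_le_const n (f : nat -> R) M :
  (forall k, (1 <= k <= n)%nat -> f k <= M) -> sum_n_m f 1 n <= INR n * M.
Proof.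
induction n as [|n IH]; intros H.
- rewrite sum_n_m_zero by lia; unfold zero; simpl; lra.
- rewrite sum_n_Sm by lia.
  rewrite S_INR, Rmult_plus_distr_r, Rmult_1_l.
  apply Rplus_le_compat; [apply IH; intros k Hk; apply H; lia|apply H; lia].
Qed.

(** The modulus is the geometric mean of the moduli, because [Re (ulog w)] is [ln (Cmod w)]. *)
Lemma Cmod_log_mean_le n (c : nat -> C) M : (1 <= n)%nat ->
  (forall k, (1 <= k <= n)%nat -> 0 < Im (c k)) ->
  (forall k, (1 <= k <= n)%nat -> Cmod (c k) <= M) -> Cmod (log_mean n c) <= M.
Proof.
intros Hn P H; unfold log_mean.
assert (N : 0 < INR n) by (apply lt_0_INR; lia).
assert (Q : forall k, (1 <= k <= n)%nat -> 0 < Cmod (c k)).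
{ intros k Hk; apply Cmod_gt_0; intros E; assert (Q := P k Hk); rewrite E in Q; simpl in Q; lra. }
assert (M0 : 0 < M) by (assert (Q1 := Q n ltac:(lia)); assert (H1 := H n ltac:(lia)); lra).
rewrite Cmod_Cexp, re_scal_l, Re_sum_n_m.
rewrite <- (exp_ln M) by exact M0.
assert (L : / INR n * sum_n_m (fun k => Re (ulog (c k))) 1 n <= ln M).
{ apply Rmult_le_reg_l with (INR n); [exact N|].
  rewrite <- Rmult_assoc, Rinv_r, Rmult_1_l by lra.
  apply sum_n_m_le_const; intros k Hk; simpl.
  apply ln_le; [apply Q, Hk|apply H, Hk]. }
destruct L as [L|L]; [apply Rlt_le, exp_increasing, L|rewrite L; apply Rle_refl].
Qed.

Lemma log_mean_const n (w : C) : (1 <= n)%nat -> 0 < Im w -> log_mean n (fun _ => w) = w.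
Proof.
intros Hn P; unfold log_mean.
assert (N : 0 < INR n) by (apply lt_0_INR; lia).
assert (E : forall m, sum_n_m (fun _ : nat => ulog w) 1 m = (RtoC (INR m) * ulog w)%C).
{ induction m as [|m IH].
  - rewrite sum_n_m_zero by lia; change (RtoC 0 = RtoC (INR 0) * ulog w)%C; simpl; ring.
  - rewrite sum_n_Sm, IH, S_INR, RtoC_plus by lia.
    change (RtoC (INR m) * ulog w + ulog w = (RtoC (INR m) + RtoC 1) * ulog w)%C; ring. }
rewrite E, Cmult_assoc, <- RtoC_mult, Rinv_l, Cmult_1_l by lra.
rewrite ulog_Cln by exact P.
assert (M : 0 < Cmod w) by (apply Cmod_gt_0; intros ->; simpl in P; lra).
destruct (Carg_spec w) as [_ S]; [intros [Q _]; lra|].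
unfold Cexp, Cln; cbn [Re Im fst snd]; rewrite exp_ln by exact M; symmetry; exact S.
Qed.

Lemma Cmod_le_Re_Im (w : C) K : Rabs (Re w) <= K -> Rabs (Im w) <= K -> Cmod w <= 2 * K.
Proof.
intros H1 H2; assert (P := Cmod_ge_0 w); assert (E := Cmod2_alt w).
assert (Rabs (Re w) ^ 2 = Re w ^ 2) by apply pow2_abs.
assert (Rabs (Im w) ^ 2 = Im w ^ 2) by apply pow2_abs.
assert (P1 := Rabs_pos (Re w)); assert (P2 := Rabs_pos (Im w)).
nra.
Qed.

(** Two mean value steps: [f 1 - f 0 = f' c] and [f' c - f' 0 = f'' d * c] with [0 <= c <= 1]. The
    sharper factor 1/2 is given up. Complex functions are treated through their real and imaginary
    parts. *)
Lemma taylor_bound (f f' f'' : R -> R) K :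
  (forall s, is_derive f s (f' s)) -> (forall s, is_derive f' s (f'' s)) ->
  (forall s, 0 <= s <= 1 -> Rabs (f'' s) <= K) -> Rabs (f 1 - f 0 - f' 0) <= K.
Proof.
intros H1 H2 HK.
assert (C : forall (g g' : R -> R) s, (forall s, is_derive g s (g' s)) -> continuity_pt g s).
{ intros g g' s H; apply continuity_pt_filterlim, (ex_derive_continuous g); eexists; apply H. }
destruct (MVT_gen f 0 1 f') as [c [Hc Ec]]; [auto|intros; eapply C, H1|].
rewrite Rmin_left, Rmax_right in Hc by lra.
destruct (MVT_gen f' 0 c f'') as [d [Hd Ed]]; [auto|intros; eapply C, H2|].
rewrite Rmin_left, Rmax_right in Hd by lra.
replace (f 1 - f 0 - f' 0) with (f'' d * c) by lra.
rewrite Rabs_mult, (Rabs_pos_eq c) by lra.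
assert (Q := HK d ltac:(lra)); assert (P := Rabs_pos (f'' d)); nra.
Qed.

Lemma RtoC_arith_mean n a : Cmean n (fun k => RtoC (a k)) = RtoC (arith_mean n a).
Proof.
unfold Cmean, arith_mean; rewrite RtoC_mult; f_equal.
apply C_eq; [rewrite Re_sum_n_m; reflexivity|].
rewrite Im_sum_n_m; simpl; clear.
induction n as [|n IH]; [rewrite sum_n_m_zero by lia; reflexivity|].
rewrite sum_n_Sm, IH by lia; unfold plus; simpl; ring.
Qed.

Lemma Cmean_mult_r n (f : nat -> C) (c : C) :
  Cmean n (fun k => f k * c)%C = (Cmean n f * c)%C.
Proof.
unfold Cmean; rewrite <- Cmult_assoc; f_equal.
exact (sum_n_m_mult_r (K := C_Ring) c f 1 n).
Qed.

Lemma Cmean_ext n (f g : nat -> C) :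
  (forall k, (1 <= k <= n)%nat -> f k = g k) -> Cmean n f = Cmean n g.
Proof. intros H; unfold Cmean; f_equal; apply sum_n_m_ext_loc, H. Qed.

(** * Second-order expansion of the mean along [s a + w] *)

Section Taylor.
Variables (n : nat) (a : nat -> R) (w : C) (S : R).
Hypothesis n_pos : (1 <= n)%nat.
Hypothesis w_pos : 0 < Im w.
Hypothesis a_le : forall k, (1 <= k <= n)%nat -> Rabs (a k) <= S.
Hypothesis w_large : 2 * S <= Cmod w.

Let c (k : nat) (s : R) : C := (RtoC (s * a k) + w)%C.
Let L (s : R) : C := log_mean n (fun k => c k s).
Let B (s : R) : C := Cmean n (fun k => RtoC (a k) / c k s)%C.
Let B' (s : R) : C := Cmean n (fun k => - (RtoC (a k) * RtoC (a k) / (c k s * c k s)))%C.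

Lemma shift_Im k s : Im (c k s) = Im w.
Proof. unfold c; simpl; unfold Im; ring. Qed.

Lemma shift_neq0 k s : c k s <> 0%C.
Proof.
intros E; assert (K := shift_Im k s); rewrite E in K; simpl in K; lra.
Qed.

Lemma Cderive_shift k s : Cderive (c k) s (RtoC (a k)).
Proof.
eapply Cderive_eq; [apply (Cderive_plus (fun t => RtoC (t * a k)) (fun _ => w) s (RtoC (a k)))|].
- split; [|exact (is_derive_const _ s)].
  change (is_derive (fun t => t * a k) s (a k)); auto_derive; [exact I|ring].
- apply Cderive_const.
- ring.
Qed.

Lemma Cderive_log_mean_shift s : Cderive L s (B s * L s)%C.
Proof.
apply (Cderive_log_mean n c (fun k => RtoC (a k))); intros k _.
- apply Cderive_shift.
- rewrite shift_Im; exact w_pos.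
Qed.

Lemma Cderive_mean_quotient s : Cderive B s (B' s).
Proof.
eapply Cderive_eq.
- apply Cderive_mult; [apply Cderive_const|].
  apply (Cderive_sum (fun k t => RtoC (a k) / c k t)%C); intros k _.
  apply Cderive_mult; [apply Cderive_const|].
  apply Cderive_inv; [apply Cderive_shift|apply shift_neq0].
- unfold B', Cmean; rewrite Cmult_0_l, Cplus_0_l; f_equal.
  apply sum_n_m_ext; intros k.
  match goal with |- ?u = ?v => change (@eq C u v) end; field; apply shift_neq0.
Qed.

Lemma entry_bound_ge0 : 0 <= S.
Proof. assert (K := a_le n ltac:(lia)); assert (P := Rabs_pos (a n)); lra. Qed.

Lemma w_mod_pos : 0 < Cmod w.
Proof. apply Cmod_gt_0; intros E; rewrite E in w_pos; simpl in w_pos; lra. Qed.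

Lemma shift_mod k s : (1 <= k <= n)%nat -> 0 <= s <= 1 ->
  Cmod w / 2 <= Cmod (c k s) <= Cmod w * (3 / 2).
Proof.
intros Hk Hs; assert (K := a_le k Hk).
assert (D : Cmod (RtoC (s * a k)) <= S).
{ rewrite Cmod_R, Rabs_mult, (Rabs_pos_eq s) by lra.
  assert (P := Rabs_pos (a k)); nra. }
assert (T1 := Cmod_triangle (RtoC (s * a k)) w).
assert (T2 := Cmod_triangle (c k s) (- RtoC (s * a k))).
replace (c k s + - RtoC (s * a k))%C with w in T2 by (unfold c; ring).
rewrite Cmod_opp in T2; unfold c in *; lra.
Qed.

Lemma Cmod_log_mean_shift s : 0 <= s <= 1 -> Cmod (L s) <= Cmod w * (3 / 2).
Proof.
intros Hs; apply Cmod_log_mean_le; [exact n_pos| |]; intros k Hk.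
- rewrite shift_Im; exact w_pos.
- apply shift_mod; assumption.
Qed.

Lemma Cmod_quotient k s : (1 <= k <= n)%nat -> 0 <= s <= 1 ->
  Cmod (RtoC (a k) / c k s) <= 2 * S / Cmod w.
Proof.
intros Hk Hs; destruct (shift_mod k s Hk Hs) as [K _].
assert (P := w_mod_pos); assert (A := a_le k Hk).
rewrite Cmod_div, Cmod_R by apply shift_neq0.
apply Rle_trans with (S / (Cmod w / 2)); [|right; field; lra].
apply Rmult_le_compat; [apply Rabs_pos|apply Rlt_le, Rinv_0_lt_compat; lra|exact A|].
apply Rinv_le_contravar; lra.
Qed.

(** With [L] the mean of [s a + w] and [B] the mean of [a_k / (s a_k + w)], [L' = B L] and
    [L'' = (B' + B^2) L]; at [s = 0] the value is [w] and the slope [A_n(a)]. For [2 S <= |w|] the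
    shifted entries have moduli between [|w| / 2] and [3 |w| / 2], so [|L''| <= 2 (2 S / |w|)^2 (3
    |w| / 2) = 12 S^2 / |w|]. Bounding real and imaginary parts separately doubles this to 24. *)
Lemma log_mean_taylor :
  Cmod (log_mean n (fun k => RtoC (a k) + w) - w - RtoC (arith_mean n a))%C
    <= 24 * S ^ 2 / Cmod w.
Proof.
assert (P := w_mod_pos); assert (S0 := entry_bound_ge0).
set (D := fun s => (B s * L s)%C).
set (D2 := fun s => (B' s * L s + B s * (B s * L s))%C).
assert (H1 : forall s, Cderive L s (D s)) by exact Cderive_log_mean_shift.
assert (H2 : forall s, Cderive D s (D2 s))
  by (intros s; apply Cderive_mult; [apply Cderive_mean_quotient|apply Cderive_log_mean_shift]).
assert (HK : forall s, 0 <= s <= 1 -> Cmod (D2 s) <= 12 * S ^ 2 / Cmod w).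
{ intros s Hs; unfold D2.
  replace (B' s * L s + B s * (B s * L s))%C with ((B' s + B s * B s) * L s)%C by ring.
  assert (b : Cmod (B s) <= 2 * S / Cmod w).
  { apply Cmod_mean_le; [exact n_pos|]; intros k Hk; apply Cmod_quotient; assumption. }
  assert (b' : Cmod (B' s) <= (2 * S / Cmod w) ^ 2).
  { apply Cmod_mean_le; [exact n_pos|]; intros k Hk.
    assert (Q := Cmod_quotient k s Hk Hs).
    replace (RtoC (a k) * RtoC (a k) / (c k s * c k s))%C
      with ((RtoC (a k) / c k s) * (RtoC (a k) / c k s))%C by (field; apply shift_neq0).
    rewrite Cmod_opp, Cmod_mult.
    assert (Q0 := Cmod_ge_0 (RtoC (a k) / c k s)); nra. }
  assert (l := Cmod_log_mean_shift s Hs).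
  rewrite Cmod_mult.
  assert (t := Cmod_triangle (B' s) (B s * B s)); rewrite Cmod_mult in t.
  assert (t0 := Cmod_ge_0 (B' s + B s * B s)); assert (b0 := Cmod_ge_0 (B s)).
  assert (u : Cmod (B' s + B s * B s) <= 2 * (2 * S / Cmod w) ^ 2) by nra.
  apply Rle_trans with (2 * (2 * S / Cmod w) ^ 2 * (Cmod w * (3 / 2))).
  - apply Rmult_le_compat; [exact t0|apply Cmod_ge_0|exact u|exact l].
  - right; field; lra. }
assert (E1 : log_mean n (fun k => RtoC (a k) + w)%C = L 1).
{ unfold L, log_mean; do 2 f_equal; apply sum_n_m_ext; intros k; unfold c.
  rewrite Rmult_1_l; reflexivity. }
assert (c0 : forall k, c k 0 = w) by (intros k; unfold c; rewrite Rmult_0_l; ring).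
assert (E0 : L 0 = w).
{ transitivity (log_mean n (fun _ => w)); [|exact (log_mean_const n w n_pos w_pos)].
  unfold L, log_mean; do 2 f_equal; apply sum_n_m_ext; intros k; rewrite c0; reflexivity. }
assert (ED : D 0 = RtoC (arith_mean n a)).
{ unfold D; rewrite E0, <- RtoC_arith_mean; unfold B; rewrite <- Cmean_mult_r.
  apply Cmean_ext; intros k _; rewrite c0; field.
  intros E; rewrite E in w_pos; simpl in w_pos; lra. }
rewrite E1; rewrite <- E0 at 1; rewrite <- ED.
replace (24 * S ^ 2 / Cmod w) with (2 * (12 * S ^ 2 / Cmod w)) by (field; lra).
apply Cmod_le_Re_Im.
- apply (taylor_bound (fun s => Re (L s)) (fun s => Re (D s)) (fun s => Re (D2 s)));
    [intros s; apply H1|intros s; apply H2|].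
  intros s Hs; eapply Rle_trans; [apply re_le_Cmod|apply HK, Hs].
- apply (taylor_bound (fun s => Im (L s)) (fun s => Im (D s)) (fun s => Im (D2 s)));
    [intros s; apply H1|intros s; apply H2|].
  intros s Hs; eapply Rle_trans; [|apply HK, Hs].
  eapply Rle_trans; [apply Rmax_r|apply (Rmax_Cmod (D2 s))].
Qed.
End Taylor.

(* [G_n(a + w) - w - A_n(a)], continued to the closed upper half-plane (and
   reflected below it, only to have a function continuous everywhere). *)
Definition excess (n : nat) (a : nat -> R) (w : C) : C :=
  (umean n a (reflect w) - w - RtoC (arith_mean n a))%C.

Definition excess' (n : nat) (a : nat -> R) (w : C) : C :=
  (Cmean n (fun k => / (RtoC (a k) + w)) * umean n a (reflect w) - 1)%C.

Section Excess.
Variables (n : nat) (a : nat -> R) (S : R).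
Hypothesis n_pos : (1 <= n)%nat.
Hypothesis a_le : forall k, (1 <= k <= n)%nat -> Rabs (a k) <= S.

Lemma excess_log_mean (w : C) : 0 < Im w ->
  excess n a w = (log_mean n (fun k => RtoC (a k) + w) - w - RtoC (arith_mean n a))%C.
Proof.
intros P; unfold excess, log_mean.
rewrite reflect_id, umean_exp by lra; reflexivity.
Qed.

Lemma continuous_excess (w : C) : continuous (excess n a) w.
Proof.
apply continuous_Cminus; [apply continuous_Cminus|apply continuous_const].
- apply continuous_umean_reflect, n_pos.
- apply (continuous_id (U := C_UniformSpace)).
Qed.

Lemma shifted_entry_neq0 k (w : C) : 0 < Im w -> (RtoC (a k) + w)%C <> 0%C.
Proof.
intros P E; apply (f_equal Im) in E; simpl in E; unfold Im in P; lra.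
Qed.

Lemma continuous_excess' (w : C) : 0 < Im w -> continuous (excess' n a) w.
Proof.
intros P; apply continuous_Cminus; [|apply continuous_const].
apply continuous_Cmult; [|apply continuous_umean_reflect, n_pos].
apply continuous_Cmult; [apply continuous_const|].
apply (continuous_Csum (fun k v => / (RtoC (a k) + v))%C); intros k _.
apply continuous_Cinv; [|apply shifted_entry_neq0, P].
apply continuous_Cplus; [apply continuous_const|apply (continuous_id (U := C_UniformSpace))].
Qed.

Lemma Cderive_excess (c : R -> C) s l : Cderive c s l -> 0 < Im (c s) ->
  Cderive (fun t => excess n a (c t)) s (l * excess' n a (c s))%C.
Proof.
intros H P.
assert (K : Cderive (fun t => log_mean n (fun k => RtoC (a k) + c t)
    - c t - RtoC (arith_mean n a))%C s (l * excess' n a (c s))%C).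
{ eapply Cderive_eq.
  - apply Cderive_minus; [apply Cderive_minus; [|exact H]|apply Cderive_const].
    apply (Cderive_log_mean n (fun k t => RtoC (a k) + c t)%C (fun _ => 0 + l)%C).
    + intros k _; apply Cderive_plus; [apply Cderive_const|exact H].
    + intros k _; simpl; unfold Im in P; lra.
  - unfold excess'; rewrite reflect_id, umean_exp by lra; unfold log_mean.
    rewrite (Cmean_ext n _ (fun k => / (RtoC (a k) + c s) * l)%C), Cmean_mult_r; [ring|].
    intros k _; field; apply shifted_entry_neq0, P. }
(* The differentiable form equals [excess] only above the axis; the curve stays there near [s],
   which is enough for a derivative. *)
assert (Lo : locally s (fun t => 0 < Im (c t))).
{ assert (Cn : continuous (fun t => Im (c t)) s)
    by (apply (ex_derive_continuous (fun t => Im (c t))); eexists; apply H).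
  apply Cn, (open_gt 0), P. }
split.
- apply (is_derive_ext_loc (fun t => Re (log_mean n (fun k => RtoC (a k) + c t)
    - c t - RtoC (arith_mean n a))%C)); [|apply K].
  revert Lo; apply filter_imp; intros t Ht; rewrite excess_log_mean by exact Ht; reflexivity.
- apply (is_derive_ext_loc (fun t => Im (log_mean n (fun k => RtoC (a k) + c t)
    - c t - RtoC (arith_mean n a))%C)); [|apply K].
  revert Lo; apply filter_imp; intros t Ht; rewrite excess_log_mean by exact Ht; reflexivity.
Qed.

(** These are the bounds required by the two mean value applications, with [v = x]. For [|w| >= 2 S]
    they follow from the expansion; for smaller [|w|] the triangle inequality gives
    [3 S + 2 S + S = 6 S]. The product uses [|w - v| <= |w| + |v|]. *)
Lemma excess_bound (v w : C) : 0 < Im w ->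
  Cmod ((w - v) * excess n a w) <= 24 * S ^ 2 + 12 * S * Cmod v /\
  Cmod (excess n a w) <= 12 * S.
Proof.
intros P.
assert (S0 : 0 <= S)
  by (assert (K := a_le n ltac:(lia)); assert (Q := Rabs_pos (a n)); lra).
assert (M : 0 < Cmod w) by (apply Cmod_gt_0; intros E; rewrite E in P; simpl in P; lra).
assert (V := Cmod_ge_0 v).
assert (T : Cmod (w - v) <= Cmod w + Cmod v)
  by (rewrite <- (Cmod_opp v); apply Cmod_triangle).
assert (T0 := Cmod_ge_0 (w - v)).
rewrite Cmod_mult.
set (e := Cmod (excess n a w)).
assert (e0 : 0 <= e) by apply Cmod_ge_0.
destruct (Rle_dec (2 * S) (Cmod w)) as [W|W].
- assert (K := log_mean_taylor n a w S n_pos P a_le W).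
  rewrite <- excess_log_mean in K by exact P; fold e in K.
  assert (K1 : e * Cmod w <= 24 * S ^ 2).
  { replace (24 * S ^ 2) with (24 * S ^ 2 / Cmod w * Cmod w) by (field; lra).
    apply Rmult_le_compat_r; lra. }
  assert (K2 : e <= 12 * S).
  { destruct (Req_dec S 0) as [Z|Z]; [rewrite Z in *; nra|].
    assert (e * (2 * S) <= 24 * S ^ 2) by nra. nra. }
  split; [nra|exact K2].
- assert (K : e <= 6 * S).
  { unfold e; rewrite excess_log_mean by exact P; unfold Cminus.
    eapply Rle_trans; [apply Cmod_triangle|].
    rewrite Cmod_opp, <- RtoC_arith_mean.
    assert (m : Cmod (Cmean n (fun k => RtoC (a k))) <= S).
    { apply Cmod_mean_le; [exact n_pos|]; intros k Hk; rewrite Cmod_R; apply a_le, Hk. }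
    assert (l : Cmod (log_mean n (fun k => RtoC (a k) + w)%C) <= 3 * S).
    { apply Cmod_log_mean_le; [exact n_pos| |]; intros k Hk.
      - simpl; unfold Im in P; lra.
      - eapply Rle_trans; [apply Cmod_triangle|].
        rewrite Cmod_R; assert (A := a_le k Hk); lra. }
    assert (t := Cmod_triangle (log_mean n (fun k => RtoC (a k) + w)%C) (- w)).
    rewrite Cmod_opp in t; lra. }
  split; [nra|lra].
Qed.
End Excess.

(** * Boundary values *)

Lemma prod_n_m_S f n : prod_n_m f 1 (S n) = prod_n_m f 1 n * f (S n).
Proof.
unfold prod_n_m.
replace (S (S n) - 1)%nat with (S n) by lia; replace (S n - 1)%nat with n by lia.
rewrite seq_S, map_app; simpl.
generalize (map f (seq 1 n)); induction l as [|u l IH]; simpl; [ring|].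
rewrite IH; ring.
Qed.

Lemma nroot_mult n x y : 0 <= x -> 0 <= y -> nroot n (x * y) = nroot n x * nroot n y.
Proof.
intros Hx Hy; unfold nroot.
destruct (Req_EM_T x 0) as [->|Nx]; [destruct (Req_EM_T (0 * y) 0); lra|].
destruct (Req_EM_T y 0) as [->|Ny]; [destruct (Req_EM_T (x * 0) 0); lra|].
destruct (Req_EM_T (x * y) 0) as [E|_].
- apply Rmult_integral in E; lra.
- symmetry; apply Rpower_mult_distr; lra.
Qed.

Lemma nroot_1 n : nroot n 1 = 1.
Proof.
unfold nroot; destruct (Req_EM_T 1 0); [lra|].
unfold Rpower; rewrite ln_1, Rmult_0_r; apply exp_0.
Qed.

Lemma Cexp_real_add (x t : R) : Cexp (x, t) = (RtoC (exp x) * Cexp (0, t))%C.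
Proof.
rewrite <- (Rplus_0_r x) at 1; rewrite <- (Rplus_0_l t) at 1.
change (x + 0, 0 + t) with (RtoC x + (0, t))%C.
rewrite Cexp_plus; f_equal.
unfold Cexp; simpl; rewrite cos_0, sin_0; apply C_eq; simpl; ring.
Qed.

Lemma Cexp_0 : Cexp (0, 0) = 1%C.
Proof. unfold Cexp; simpl; rewrite exp_0, cos_0, sin_0; apply C_eq; simpl; ring. Qed.

(** At [x = 0] the root vanishes, so any angle may be attached to it. Hence an entry equal to [t]
    can be counted on either side in [umean_boundary]. *)
Lemma uroot_real n x t : uarg (RtoC x) = t \/ x = 0 ->
  uroot n (RtoC x) = (RtoC (nroot n (Rabs x)) * Cexp (0, / INR n * t)%R)%C.
Proof.
intros H; unfold uroot, nroot; rewrite Cmod_R.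
destruct (Req_EM_T (Rabs x) 0) as [E|E]; [ring|].
destruct H as [H|H]; [|destruct E; rewrite H; apply Rabs_R0].
unfold ulog; rewrite H, Cmod_R.
replace (RtoC (/ INR n) * (ln (Rabs x), t))%C with (/ INR n * ln (Rabs x), / INR n * t)
  by (apply C_eq; simpl; ring).
apply Cexp_real_add.
Qed.

Lemma uarg_nonneg x : 0 < x -> uarg (RtoC x) = 0.
Proof.
intros H; unfold uarg; rewrite Cmod_R, Rabs_pos_eq by lra; simpl.
replace (x / (x + 0)) with 1 by (field; lra); rewrite atan_1; field.
Qed.

Lemma uarg_nonpos x : x < 0 -> uarg (RtoC x) = PI.
Proof.
intros H; unfold uarg; rewrite Cmod_R, Rabs_left by lra; simpl.
replace (x / (- x + 0)) with (- (1)) by (field; lra); rewrite atan_opp, atan_1; field.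
Qed.

Lemma umean_boundary n a t l :
  (forall k, (1 <= k <= l)%nat -> a k <= t) ->
  (forall k, (l < k <= n)%nat -> t <= a k) -> (l <= n)%nat ->
  umean n a (RtoC (- t)) =
  (RtoC (nroot n (Rabs (prod_n_m (fun k => a k - t)%R 1 n))) * Cexp (0, INR l * PI / INR n)%R)%C.
Proof.
intros H1 H2 Hl; unfold umean.
(* The root index [n] stays fixed while the number [m] of factors grows; [Nat.min m l] counts those
   to which the angle PI is assigned. *)
assert (G : forall m, (m <= n)%nat ->
  Cprod (fun k => uroot n (RtoC (a k) + RtoC (- t))%C) m =
  (RtoC (nroot n (Rabs (prod_n_m (fun k => a k - t)%R 1 m))) *
   Cexp (0, INR (Nat.min m l) * (/ INR n * PI))%R)%C).
{ induction m as [|m IH]; intros Hm.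
  - simpl; rewrite Rmult_0_l, Cexp_0; unfold prod_n_m; simpl.
    rewrite Rabs_R1, nroot_1; ring.
  - cbn [Cprod]; rewrite IH, prod_n_m_S, Rabs_mult, nroot_mult by (apply Rabs_pos || lia).
    rewrite <- RtoC_plus, RtoC_mult.
    change (a (S m) + - t) with (a (S m) - t).
    destruct (Nat.le_gt_cases (S m) l) as [L|L].
    + rewrite (uroot_real n (a (S m) - t) PI).
      * replace (Nat.min m l) with m by lia; replace (Nat.min (S m) l) with (S m) by lia.
        rewrite S_INR.
        replace (0, (INR m + 1) * (/ INR n * PI)) with ((0, INR m * (/ INR n * PI))%R + (0, / INR n * PI)%R)%C
          by (apply C_eq; simpl; ring).
        rewrite Cexp_plus; ring.
      * assert (K := H1 (S m) ltac:(lia)).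
        destruct (Req_dec (a (S m) - t) 0); [right; assumption|left; apply uarg_nonpos; lra].
    + rewrite (uroot_real n (a (S m) - t) 0).
      * replace (Nat.min m l) with l by lia; replace (Nat.min (S m) l) with l by lia.
        rewrite Rmult_0_r, Cexp_0; ring.
      * assert (K := H2 (S m) ltac:(lia)).
        destruct (Req_dec (a (S m) - t) 0); [right; assumption|left; apply uarg_nonneg; lra]. }
rewrite G by lia; replace (Nat.min n l) with l by lia.
do 3 f_equal; unfold Rdiv; ring.
Qed.

Lemma Im_excess_boundary n a t l :
  (forall k, (1 <= k <= l)%nat -> a k <= t) ->
  (forall k, (l < k <= n)%nat -> t <= a k) -> (l <= n)%nat ->
  Im (excess n a (RtoC (- t))) =
  sin (INR l * PI / INR n) * nroot n (Rabs (prod_n_m (fun k => a k - t) 1 n)).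
Proof.
intros H1 H2 Hl; unfold excess.
rewrite reflect_id by (simpl; lra); rewrite (umean_boundary n a t l H1 H2 Hl).
unfold Cexp; simpl; rewrite exp_0; ring.
Qed.

Lemma mono_le n (a : nat -> R) i j :
  (forall k, (1 <= k <= n - 1)%nat -> a k <= a (S k)) ->
  (1 <= i)%nat -> (i <= j)%nat -> (j <= n)%nat -> a i <= a j.
Proof.
intros H Hi L; induction L as [|j L IH]; intros Hj; [lra|].
eapply Rle_trans; [apply IH; lia|apply H; lia].
Qed.

Lemma sum_RInt_Chasles (g : R -> R) (a : nat -> R) n : (1 <= n)%nat ->
  (forall x, continuous g x) ->
  sum_n_m (fun l => RInt g (a l) (a (S l))) 1 (n - 1) = RInt g (a 1%nat) (a n).
Proof.
intros Hn Hg.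
assert (EX : forall u v, ex_RInt g u v)
  by (intros u v; apply (ex_RInt_continuous (V := R_CompleteNormedModule)); auto).
destruct n as [|n]; [lia|clear Hn]; replace (S n - 1)%nat with n by lia.
induction n as [|n IH].
- rewrite sum_n_m_zero, RInt_point by lia; reflexivity.
- rewrite sum_n_Sm, IH by lia; apply RInt_Chasles; apply EX.
Qed.

(** * Poisson's formula for the half-plane *)

Lemma sum_sq_neq0 u v : v <> 0 -> u ^ 2 + v ^ 2 <> 0.
Proof.
intros H; assert (P := pow2_ge_0 u); assert (Q := pow2_gt_0 v H); lra.
Qed.

(* The parameter at which the boundary circle passes through [- t]. *)
Definition half_angle (x y t : R) : R := 2 * atan ((t + x) / y).

Section Boundary.
Variables (F F' : C -> C) (x y M t1 t2 : R).
Hypothesis y_pos : 0 < y.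
Hypothesis F_cont : forall w, continuous F w.
Hypothesis F'_cont : forall w, 0 < Im w -> continuous F' w.
Hypothesis F_derive : forall (c : R -> C) (s : R) (l : C),
  Cderive c s l -> 0 < Im (c s) -> Cderive (fun t => F (c t)) s (l * F' (c s))%C.
Hypothesis F_bound : forall w, 0 < Im w -> Rabs (Im (F w)) <= M.
Hypothesis t12 : t1 <= t2.
Hypothesis F_supp : forall t, t <= t1 \/ t2 <= t -> Im (F (RtoC (- t))) = 0.

Lemma half_angle_bound t : - PI < half_angle x y t < PI.
Proof. unfold half_angle; destruct (atan_bound ((t + x) / y)); lra. Qed.

Lemma half_angle_lt s t : s < t -> half_angle x y s < half_angle x y t.
Proof.
intros H; unfold half_angle; apply Rmult_lt_compat_l; [lra|].
apply atan_increasing, Rmult_lt_compat_r; [apply Rinv_0_lt_compat, y_pos|lra].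
Qed.

Lemma disc_map_half_angle t : disc_map x y 1 (half_angle x y t) = RtoC (- t).
Proof.
unfold half_angle; set (u := (t + x) / y).
assert (Hc : 0 < cos (atan u)) by (destruct (atan_bound u); apply cos_gt_0; lra).
assert (Ht : t = y * tan (atan u) - x) by (rewrite tan_atan; unfold u; field; lra).
unfold disc_map, disc_den; rewrite cos_2a_cos, sin_2a.
apply C_eq; simpl.
- rewrite Ht; unfold tan; field; split; [lra|nra].
- field; nra.
Qed.

Lemma half_angle_surj th : - PI < th < PI -> exists t, half_angle x y t = th.
Proof.
intros H; exists (y * tan (th / 2) - x); unfold half_angle.
replace ((y * tan (th / 2) - x + x) / y) with (tan (th / 2)) by (field; lra).
rewrite atan_tan by lra; field.
Qed.

Lemma is_derive_half_angle (t : R) :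
  is_derive (half_angle x y) t (2 * y / ((t + x) ^ 2 + y ^ 2)).
Proof.
unfold half_angle; auto_derive; [exact I|].
field; split; [apply sum_sq_neq0|]; lra.
Qed.

Let trace th := Im (F (disc_map x y 1 th)).

Lemma continuous_trace th : - PI < th < PI -> continuous trace th.
Proof.
intros H; apply (continuous_section (fun q => Im (F (disc_map x y (fst q) (snd q))))).
assert (K := disc_den_1_pos th H).
exact (continuous_pullback F x y F_cont 1 th ltac:(lra)).
Qed.

Lemma ex_RInt_trace u v : - PI < u < PI -> - PI < v < PI -> ex_RInt trace u v.
Proof.
intros Hu Hv; apply (ex_RInt_continuous (V := R_CompleteNormedModule)); intros th Hth.
apply continuous_trace; split.
- eapply Rlt_le_trans; [|apply Hth]; apply Rmin_glb_lt; lra.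
- eapply Rle_lt_trans; [apply Hth|]; apply Rmax_lub_lt; lra.
Qed.

Lemma trace_outside th : - PI < th < PI ->
  th <= half_angle x y t1 \/ half_angle x y t2 <= th -> trace th = 0.
Proof.
intros H H'; destruct (half_angle_surj th H) as [t <-]; unfold trace.
rewrite disc_map_half_angle; apply F_supp.
destruct H' as [H'|H'].
- left; apply Rnot_lt_le; intros L; apply half_angle_lt in L; lra.
- right; apply Rnot_lt_le; intros L; apply half_angle_lt in L; lra.
Qed.

Lemma RInt_trace_outside u v : - PI < u -> u <= v -> v < PI ->
  v <= half_angle x y t1 \/ half_angle x y t2 <= u -> RInt trace u v = 0.
Proof.
intros Hu Huv Hv H.
rewrite (RInt_ext _ (fun _ => 0)).
- rewrite RInt_const; unfold scal; simpl; unfold mult; simpl; ring.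
- rewrite Rmin_left, Rmax_right by lra; intros th Hth; apply trace_outside; lra.
Qed.

(** The trace vanishes outside the support, so shrinking the omitted arcs changes only the error
    term, which tends to 0. *)
Lemma RInt_trace :
  RInt trace (half_angle x y t1) (half_angle x y t2) = 2 * PI * Im (F (x, y)).
Proof.
apply Rminus_diag_uniq, cond_eq; intros eps Heps.
set (h1 := half_angle x y t1); set (h2 := half_angle x y t2).
assert (B1 : - PI < h1 < PI) by apply half_angle_bound.
assert (B2 : - PI < h2 < PI) by apply half_angle_bound.
assert (L12 : h1 <= h2).
{ destruct t12 as [L|E]; [apply Rlt_le, half_angle_lt, L|unfold h1, h2; rewrite E; lra]. }
assert (M0 : 0 <= M)
  by (eapply Rle_trans; [apply Rabs_pos|apply (F_bound (x, y)); exact y_pos]).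
(* The first two bounds keep [[h1, h2]] inside the arc; the third makes the error [2 M d] smaller
   than [eps], with [M + 1] allowing [M = 0]. *)
set (d := Rmin (Rmin (h1 + PI) (PI - h2)) (eps / (4 * (M + 1)))).
assert (e0 : 0 < eps / (4 * (M + 1))) by (apply Rdiv_lt_0_compat; lra).
assert (d0 : 0 < d) by (unfold d; repeat apply Rmin_pos; lra).
assert (d1 : d <= h1 + PI) by (eapply Rle_trans; [apply Rmin_l|apply Rmin_l]).
assert (d2 : d <= PI - h2) by (eapply Rle_trans; [apply Rmin_l|apply Rmin_r]).
assert (d3 : d <= eps / (4 * (M + 1))) by apply Rmin_r.
assert (K : Rabs (RInt trace (- PI + d) (PI - d) - 2 * PI * Im (F (x, y)))
            <= M * ((- PI + d + PI) + (PI - (PI - d))))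
  by (exact (boundary_mean_value F F' x y M y_pos F_cont F'_cont F_derive F_bound
        (- PI + d) (PI - d) ltac:(lra) ltac:(lra) ltac:(lra))).
rewrite <- (RInt_Chasles trace (- PI + d) h1 (PI - d)),
  <- (RInt_Chasles trace h1 h2 (PI - d)) in K by (apply ex_RInt_trace; lra).
rewrite (RInt_trace_outside (- PI + d) h1), (RInt_trace_outside h2 (PI - d)) in K
  by (try (left; apply Rle_refl); try (right; apply Rle_refl); lra).
unfold plus in K; simpl in K; rewrite Rplus_0_l, Rplus_0_r in K.
rewrite Rminus_0_r; eapply Rle_lt_trans; [exact K|].
assert (E : eps = 4 * (M + 1) * (eps / (4 * (M + 1)))) by (field; lra).
nra.
Qed.

(** Poisson's formula at [x + i y]: the kernel is the derivative of [half_angle], and the range of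
    integration is cut down to an interval carrying the boundary values. *)
Lemma boundary_RInt :
  RInt (fun t => 2 * y / ((t + x) ^ 2 + y ^ 2) * Im (F (RtoC (- t)))) t1 t2
  = 2 * PI * Im (F (x, y)).
Proof.
rewrite <- RInt_trace.
rewrite <- (RInt_comp trace (half_angle x y) (fun t => 2 * y / ((t + x) ^ 2 + y ^ 2))).
- apply RInt_ext; intros t _; unfold trace; rewrite disc_map_half_angle; reflexivity.
- intros t _; apply continuous_trace, half_angle_bound.
- intros t _; split; [apply is_derive_half_angle|].
  apply (ex_derive_continuous (fun t => 2 * y / ((t + x) ^ 2 + y ^ 2))).
  auto_derive; apply sum_sq_neq0; lra.
Qed.

Lemma continuous_boundary (t : R) :
  continuous (fun t => 2 * y / ((t + x) ^ 2 + y ^ 2) * Im (F (RtoC (- t)))) t.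
Proof.
apply continuous_Rmult.
- apply (ex_derive_continuous (fun t => 2 * y / ((t + x) ^ 2 + y ^ 2))).
  auto_derive; apply sum_sq_neq0; lra.
- apply continuous_Im, (continuous_comp (fun t => RtoC (- t)) F); [|apply F_cont].
  apply continuous_C; simpl; [|apply continuous_const].
  exact (continuous_opp (fun t : R_UniformSpace => t) t (continuous_id t)).
Qed.
End Boundary.

(** * The integral representation *)

Definition root_weight (n : nat) (a : nat -> R) (t : R) : R :=
  nroot n (Rabs (prod_n_m (fun k => a k - t) 1 n)).

Lemma continuous_root_weight n a t : (1 <= n)%nat -> continuous (root_weight n a) t.
Proof.
intros Hn; unfold root_weight.
(* Passing through the complex root reuses its continuity at the zeros of the product. *)
apply (continuous_ext (fun t => Cmod (uroot n (RtoC (prod_n_m (fun k => a k - t) 1 n))))).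
{ intros s; rewrite Cmod_uroot, Cmod_R; reflexivity. }
apply continuous_Cmod.
apply (continuous_comp (fun t => RtoC (prod_n_m (fun k => a k - t) 1 n)) (uroot n)).
- apply continuous_C; simpl; [|apply continuous_const].
  generalize n at 1; induction n0 as [|m IH].
  + apply continuous_const.
  + apply (continuous_ext (fun t => prod_n_m (fun k => a k - t) 1 m * (a (S m) - t))).
    { intros s; symmetry; apply (prod_n_m_S (fun k => a k - s)). }
    apply continuous_Rmult; [exact IH|].
    apply continuous_Rminus; [apply continuous_const|apply continuous_id].
- apply continuous_uroot; [exact Hn|simpl; lra].
Qed.

Lemma RInt_C (h : R -> C) u v :
  (forall t, Rmin u v <= t <= Rmax u v -> continuous h t) ->
  RInt (V := C_R_CompleteNormedModule) h u v
  = (RInt (fun t => Re (h t)) u v, RInt (fun t => Im (h t)) u v).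
Proof.
intros H; apply is_RInt_unique.
apply (is_RInt_fct_extend_pair (U := R_NormedModule) (V := R_NormedModule));
  apply (RInt_correct (V := R_CompleteNormedModule)), ex_RInt_continuous; intros t Ht.
- apply continuous_Re, H, Ht.
- apply continuous_Im, H, Ht.
Qed.

Definition kernel (n : nat) (a : nat -> R) (z : C) (t : R) : C :=
  (RtoC (root_weight n a t) / (RtoC t + z))%C.

Lemma kernel_den_neq0 (a1 t : R) (z : C) :
  ~ ray_le (- a1) z -> a1 <= t -> (RtoC t + z)%C <> 0%C.
Proof.
intros H L E; apply H.
assert (E1 := f_equal Re E); assert (E2 := f_equal Im E); simpl in E1, E2.
unfold ray_le, Re, Im; lra.
Qed.

Lemma continuous_kernel n a z a1 t : (1 <= n)%nat ->
  ~ ray_le (- a1) z -> a1 <= t -> continuous (kernel n a z) t.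
Proof.
intros Hn H L; apply continuous_Cmult.
- apply continuous_C; simpl; [apply continuous_root_weight, Hn|apply continuous_const].
- apply continuous_Cinv; [|apply (kernel_den_neq0 a1); assumption].
  apply continuous_Cplus; [|apply continuous_const].
  apply continuous_C; simpl; [apply continuous_id|apply continuous_const].
Qed.

Lemma Re_kernel n a x y t : y <> 0 ->
  Re (kernel n a (x, y) t) = root_weight n a t * ((t + x) / ((t + x) ^ 2 + y ^ 2)).
Proof.
intros H; assert (N := sum_sq_neq0 (t + x) y H).
unfold kernel; simpl; simpl in N; field; repeat split; try lra;
 intros E; apply N; rewrite <- E; ring.
Qed.

Lemma Im_kernel n a x y t : y <> 0 ->
  Im (kernel n a (x, y) t) = root_weight n a t * (- y / ((t + x) ^ 2 + y ^ 2)).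
Proof.
intros H; assert (N := sum_sq_neq0 (t + x) y H).
unfold kernel; simpl; simpl in N; field; repeat split; try lra;
 intros E; apply N; rewrite <- E; ring.
Qed.

Lemma sum_n_m_factor_l (c : R) (f g : nat -> R) m k :
  (forall l, (m <= l <= k)%nat -> f l = c * g l) ->
  sum_n_m f m k = c * sum_n_m g m k.
Proof.
intros H; rewrite (sum_n_m_ext_loc _ (fun l => c * g l) m k) by exact H.
exact (sum_n_m_mult_l (K := R_Ring) c g m k).
Qed.

Lemma slit_Im_neq0 (a1 : R) (z : C) : Im z <> 0 -> ~ ray_le a1 z.
Proof. intros H [E _]; exact (H E). Qed.

Lemma RInt_mult_const (c : R) (f g : R -> R) u v : u <= v ->
  (forall t, u <= t <= v -> continuous f t) ->
  (forall t, u <= t <= v -> g t = c * f t) -> RInt g u v = c * RInt f u v.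
Proof.
intros L Hf E.
rewrite (RInt_ext g (fun t => scal c (f t))).
- apply (RInt_scal (V := R_CompleteNormedModule)).
  apply (ex_RInt_continuous (V := R_CompleteNormedModule)).
  rewrite Rmin_left, Rmax_right by exact L; exact Hf.
- rewrite Rmin_left, Rmax_right by exact L; intros t Ht; apply E; lra.
Qed.

Lemma Cln_conj w : Cln (Cconj w) = Cconj (Cln w).
Proof.
unfold Cln, Carg; rewrite Cmod_conj, re_conj, im_conj.
apply C_eq; simpl; [reflexivity|].
rewrite Rdiv_opp_l, atan_opp; ring.
Qed.

Lemma continuous_Cln {T : UniformSpace} (f : T -> C) (s : T) :
  continuous f s -> ~ ray_le 0 (f s) -> continuous (fun t => Cln (f t)) s.
Proof.
intros H N; apply slit_pos in N.
assert (K := continuous_Cmod _ _ H).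
assert (P : 0 < Cmod (f s)).
{ assert (L := re_le_Cmod (f s)); assert (L' := Rle_abs (Re (f s))); lra. }
apply continuous_C; simpl.
- apply (continuous_comp _ ln); [exact K|apply continuous_ln, P].
- unfold Carg; apply continuous_Rmult; [apply continuous_const|].
  apply (continuous_comp _ atan); [|apply continuous_atan].
  apply continuous_Rdiv; [apply continuous_Im, H| |lra].
  apply continuous_Rplus; [exact K|apply continuous_Re, H].
Qed.

Lemma continuous_RInt_param (f : R -> R -> R) u v c : u <= v ->
  (forall t, u <= t <= v -> continuity_2d_pt f t c) ->
  (forall s, ex_RInt (fun t => f t s) u v) ->
  continuous (fun s => RInt (fun t => f t s) u v) c.
Proof.
intros L H E P [eps HP].
assert (eps_pos := cond_pos eps).
destruct (RInt_param_close f u v c (eps / 2) L ltac:(lra) H (E c)) as [d [d_pos Hd]].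
exists (mkposreal d d_pos); intros s Hs; apply HP.
apply Rle_lt_trans with (eps / 2); [|lra].
apply (Hd s); [apply Rlt_le, Hs|apply E].
Qed.

Lemma continuous_right_zero (f : R -> R) :
  continuous f 0 -> (forall s, 0 < s -> f s = 0) -> f 0 = 0.
Proof.
intros H Z; destruct (Req_dec (f 0) 0) as [E|E]; [exact E|exfalso].
destruct (H _ (locally_ball (f 0) (mkposreal _ (Rabs_pos_lt _ E)))) as [d Hd].
assert (d_pos := cond_pos d).
assert (K : ball 0 d (d / 2)).
{ change (Rabs (d / 2 - 0) < d); rewrite Rabs_pos_eq; lra. }
specialize (Hd _ K); rewrite Z in Hd by lra.
change (Rabs (0 - f 0) < Rabs (f 0)) in Hd.
rewrite Rminus_0_l, Rabs_Ropp in Hd; lra.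
Qed.

(** * From boundary values to the sum of kernel integrals *)

Section Formula.
Variables (n : nat) (a : nat -> R).
Hypothesis hn : (1 <= n)%nat.
Hypothesis a_mono : forall k, (1 <= k <= n - 1)%nat -> a k <= a (S k).

Definition kernel_RInt (z : C) (l : nat) : C :=
  RInt (V := C_R_CompleteNormedModule) (kernel n a z) (a l) (a (S l)).

Definition kernel_sum (z : C) : C :=
  sum_n_m (fun l => RtoC (sin (INR l * PI / INR n)) * kernel_RInt z l)%C 1 (n - 1).

Lemma entries_bounded : exists S, forall k, (1 <= k <= n)%nat -> Rabs (a k) <= S.
Proof.
exists (Rabs (a 1%nat) + Rabs (a n)); intros k Hk.
assert (L1 := mono_le n a 1 k a_mono ltac:(lia) ltac:(lia) ltac:(lia)).
assert (L2 := mono_le n a k n a_mono ltac:(lia) ltac:(lia) ltac:(lia)).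
unfold Rabs; repeat destruct Rcase_abs; lra.
Qed.

(** The cases [l = 0] and [l = n] of the boundary value, where the sine is [sin 0] or [sin PI]. *)
Lemma Im_excess_outside t : t <= a 1%nat \/ a n <= t -> Im (excess n a (RtoC (- t))) = 0.
Proof.
intros [H|H].
- rewrite (Im_excess_boundary n a t 0); [|intros k Hk; lia| |lia].
  + simpl; unfold Rdiv; rewrite !Rmult_0_l, sin_0; ring.
  + intros k Hk; assert (L := mono_le n a 1 k a_mono ltac:(lia) ltac:(lia) ltac:(lia)); lra.
- rewrite (Im_excess_boundary n a t n); [| |intros k Hk; lia|lia].
  + replace (INR n * PI / INR n) with PI by (field; apply not_0_INR; lia).
    rewrite sin_PI; ring.
  + intros k Hk; assert (L := mono_le n a k n a_mono ltac:(lia) ltac:(lia) ltac:(lia)); lra.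
Qed.

Lemma Im_excess_between t l : (1 <= l <= n - 1)%nat -> a l <= t <= a (S l) ->
  Im (excess n a (RtoC (- t))) = sin (INR l * PI / INR n) * root_weight n a t.
Proof.
intros Hl Ht; apply Im_excess_boundary; [| |lia].
- intros k Hk; assert (L := mono_le n a k l a_mono ltac:(lia) ltac:(lia) ltac:(lia)); lra.
- intros k Hk; assert (L := mono_le n a (S l) k a_mono ltac:(lia) ltac:(lia) ltac:(lia)); lra.
Qed.

Lemma kernel_RInt_pair z l : ~ ray_le (- a 1%nat) z -> (1 <= l <= n - 1)%nat ->
  kernel_RInt z l = (RInt (fun t => Re (kernel n a z t)) (a l) (a (S l)),
                     RInt (fun t => Im (kernel n a z t)) (a l) (a (S l))).
Proof.
intros Hz Hl; apply RInt_C; intros t Ht.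
assert (L1 := mono_le n a 1 l a_mono ltac:(lia) ltac:(lia) ltac:(lia)).
assert (L := a_mono l Hl); rewrite Rmin_left in Ht by exact L.
apply (continuous_kernel n a z (a 1%nat)); [exact hn|exact Hz|lra].
Qed.

(* Used with F = excess, r = 1, giving Im excess(x + i y), and with
   F = (w - x) excess(w), r = - t - x, giving y * Re excess(x + i y). *)
Lemma boundary_sum (F F' : C -> C) x y M (r : R -> R) : 0 < y -> (forall t, continuous r t) ->
  (forall w, continuous F w) ->
  (forall w, 0 < Im w -> continuous F' w) ->
  (forall (c : R -> C) (s : R) (l : C),
     Cderive c s l -> 0 < Im (c s) -> Cderive (fun t => F (c t)) s (l * F' (c s))%C) ->
  (forall w, 0 < Im w -> Rabs (Im (F w)) <= M) ->
  (forall t, Im (F (RtoC (- t))) = r t * Im (excess n a (RtoC (- t)))) ->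
  sum_n_m (fun l => sin (INR l * PI / INR n) *
     RInt (fun t => root_weight n a t * (2 * y / ((t + x) ^ 2 + y ^ 2) * r t)) (a l) (a (S l)))
     1 (n - 1) = 2 * PI * Im (F (x, y)).
Proof.
intros y_pos cr c1 c2 d b e.
rewrite <- (boundary_RInt F F' x y M (a 1%nat) (a n) y_pos c1 c2 d b).
(* The single integral over the support is cut at the entries, so that a fixed sine governs each
   piece. *)
- rewrite <- sum_RInt_Chasles; [|exact hn|].
  + apply sum_n_m_ext_loc; intros l Hl.
    assert (L := a_mono l Hl).
    rewrite <- (RInt_scal (V := R_CompleteNormedModule)).
    * apply RInt_ext; rewrite Rmin_left, Rmax_right by exact L; intros t Ht.
      rewrite e, (Im_excess_between t l Hl) by lra.
      unfold scal; simpl; unfold mult; simpl; ring.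
    * apply (ex_RInt_continuous (V := R_CompleteNormedModule)); intros t _.
      apply continuous_Rmult; [apply continuous_root_weight, hn|].
      apply continuous_Rmult; [|apply cr].
      apply (ex_derive_continuous (fun t => 2 * y / ((t + x) ^ 2 + y ^ 2))).
      auto_derive; apply sum_sq_neq0; lra.
  + intros t; apply continuous_boundary; assumption.
- apply mono_le with n; try assumption; lia.
- intros t Ht; rewrite e, Im_excess_outside by exact Ht; ring.
Qed.

Lemma Re_kernel_sum z : ~ ray_le (- a 1%nat) z ->
  Re (kernel_sum z) = sum_n_m (fun l => sin (INR l * PI / INR n) *
    RInt (fun t => Re (kernel n a z t)) (a l) (a (S l))) 1 (n - 1).
Proof.
intros Hz; unfold kernel_sum; rewrite Re_sum_n_m.
apply sum_n_m_ext_loc; intros l Hl.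
rewrite re_scal_l, kernel_RInt_pair by assumption; reflexivity.
Qed.

Lemma Im_kernel_sum z : ~ ray_le (- a 1%nat) z ->
  Im (kernel_sum z) = sum_n_m (fun l => sin (INR l * PI / INR n) *
    RInt (fun t => Im (kernel n a z t)) (a l) (a (S l))) 1 (n - 1).
Proof.
intros Hz; unfold kernel_sum; rewrite Im_sum_n_m.
apply sum_n_m_ext_loc; intros l Hl.
rewrite im_scal_l, kernel_RInt_pair by assumption; reflexivity.
Qed.

Lemma excess_kernel_sum x y : 0 < y ->
  kernel_sum (x, y) = (- RtoC PI * excess n a (x, y))%C.
Proof.
intros Hy; destruct entries_bounded as [S HS].
assert (Hz : ~ ray_le (- a 1%nat) (x, y)) by (apply slit_Im_neq0; simpl; lra).
assert (cont : forall t l, (1 <= l <= n - 1)%nat -> a l <= t -> continuous (kernel n a (x, y)) t).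
{ intros t l Hl Ht; apply (continuous_kernel n a _ (a 1%nat)); [exact hn|exact Hz|].
  assert (L := mono_le n a 1 l a_mono ltac:(lia) ltac:(lia) ltac:(lia)); lra. }
assert (S1 := boundary_sum (excess n a) (excess' n a) x y (12 * S) (fun _ => 1) Hy
  (fun t => continuous_const 1 t)
  (continuous_excess n a hn) (continuous_excess' n a hn) (Cderive_excess n a)).
assert (S2 := boundary_sum (fun w => (w - RtoC x) * excess n a w)%C
  (fun w => excess n a w + (w - RtoC x) * excess' n a w)%C x y
  (24 * S ^ 2 + 12 * S * Cmod (RtoC x)) (fun t => - t - x) Hy).
assert (imle : forall w : C, Rabs (Im w) <= Cmod w)
  by (intros w; eapply Rle_trans; [apply Rmax_r|apply Rmax_Cmod]).
apply C_eq.
- rewrite Re_kernel_sum by exact Hz.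
  (* This factor turns the weight [(t + x) / ((t + x)^2 + y^2)] of the real part into the Poisson
     weight times [- t - x], the value of [w - x] at [w = - t]. *)
  apply Rmult_eq_reg_l with (- 2 * y); [|lra].
  transitivity (2 * PI * Im (((x, y) - RtoC x) * excess n a (x, y))%C);
    [|generalize (excess n a (x, y)); intros [e1 e2]; simpl; ring].
  rewrite <- S2.
  + symmetry; apply sum_n_m_factor_l; intros l Hl.
    rewrite (RInt_mult_const (- 2 * y) (fun t => Re (kernel n a (x, y) t)));
      [ring|apply a_mono, Hl| |]; intros t Ht.
    * apply continuous_Re, (cont t l); [exact Hl|lra].
    * rewrite Re_kernel by lra; field; apply sum_sq_neq0; lra.
  + intros t; apply continuous_Rminus; [|apply continuous_const].
    exact (continuous_opp (fun t : R_UniformSpace => t) t (continuous_id t)).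
  + intros w; apply continuous_Cmult; [|apply continuous_excess, hn].
    apply continuous_Cminus; [apply (continuous_id (U := C_UniformSpace))|apply continuous_const].
  + intros w P; apply continuous_Cplus; [apply continuous_excess, hn|].
    apply continuous_Cmult; [|exact (continuous_excess' n a hn w P)].
    apply continuous_Cminus; [apply (continuous_id (U := C_UniformSpace))|apply continuous_const].
  + intros c s l H P; eapply Cderive_eq.
    * apply Cderive_mult; [apply Cderive_minus; [exact H|apply Cderive_const]|].
      exact (Cderive_excess n a c s l H P).
    * cbv beta; ring.
  + intros w P; eapply Rle_trans; [apply imle|].
    apply (excess_bound n a S hn HS (RtoC x) w P).
  + intros t; generalize (excess n a (RtoC (- t))); intros [e1 e2]; simpl; ring.
- rewrite Im_kernel_sum by exact Hz.
  (* Here [- y / ((t + x)^2 + y^2)] times [- 2] is already the Poisson weight. *)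
  apply Rmult_eq_reg_l with (- 2); [|lra].
  transitivity (2 * PI * Im (excess n a (x, y)));
    [|generalize (excess n a (x, y)); intros [e1 e2]; simpl; ring].
  rewrite <- S1.
  + symmetry; apply sum_n_m_factor_l; intros l Hl.
    rewrite (RInt_mult_const (- 2) (fun t => Im (kernel n a (x, y) t)));
      [ring|apply a_mono, Hl| |]; intros t Ht.
    * apply continuous_Im, (cont t l); [exact Hl|lra].
    * rewrite Im_kernel by lra; field; apply sum_sq_neq0; lra.
  + intros w P; eapply Rle_trans; [apply imle|].
    apply (excess_bound n a S hn HS (RtoC x) w P).
  + intros t; ring.
Qed.

Definition representation (z : C) : C :=
  (RtoC (arith_mean n a) + z - RtoC (/ PI) * kernel_sum z)%C.

Lemma geom_mean_upper (z : C) : 0 < Im z ->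
  geom_mean n (fun k => RtoC (a k) + z)%C = representation z.
Proof.
intros P; destruct z as [x y]; simpl in P.
unfold representation; rewrite excess_kernel_sum by exact P.
rewrite <- umean_geom_mean by exact P.
unfold excess; rewrite reflect_id by (simpl; lra).
rewrite RtoC_inv by (assert (Q := PI_RGT_0); lra).
field; intros E; apply (f_equal Re) in E; simpl in E; assert (Q := PI_RGT_0); lra.
Qed.

(** * The lower half-plane by conjugation *)

Lemma kernel_conj z t : (RtoC t + z)%C <> 0%C ->
  kernel n a (Cconj z) t = Cconj (kernel n a z t).
Proof.
intros N; unfold kernel; rewrite Cdiv_conj by exact N; rewrite Cplus_conj.
f_equal; [|f_equal]; apply C_eq; simpl; ring.
Qed.

Lemma representation_conj z : Im z <> 0 -> representation (Cconj z) = Cconj (representation z).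
Proof.
intros Hz.
assert (Hz' : Im (Cconj z) <> 0) by (rewrite im_conj; lra).
assert (N : forall t, (RtoC t + z)%C <> 0%C).
{ intros t E; apply (f_equal Im) in E; simpl in E; unfold Im in Hz; lra. }
assert (K : kernel_sum (Cconj z) = Cconj (kernel_sum z)).
{ apply C_eq; rewrite ?re_conj, ?im_conj.
  - rewrite !Re_kernel_sum by (apply slit_Im_neq0; assumption).
    apply sum_n_m_ext_loc; intros l Hl; f_equal; apply RInt_ext; intros t _.
    rewrite kernel_conj by apply N; apply re_conj.
  - rewrite !Im_kernel_sum by (apply slit_Im_neq0; assumption).
    match goal with |- _ = - ?u => replace (- u) with (- (1) * u) by ring end.
    apply sum_n_m_factor_l; intros l Hl; cbv beta.
    rewrite (RInt_mult_const (- (1)) (fun t => Im (kernel n a z t)));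
      [ring|apply a_mono, Hl| |]; intros t Ht.
    + apply continuous_Im, (continuous_kernel n a z (a 1%nat)); [exact hn|apply slit_Im_neq0, Hz|].
      assert (L := mono_le n a 1 l a_mono ltac:(lia) ltac:(lia) ltac:(lia)); lra.
    + rewrite kernel_conj by apply N; rewrite im_conj; ring. }
unfold representation; rewrite K, Cminus_conj, Cplus_conj, Cmult_conj.
f_equal; [f_equal|f_equal]; apply C_eq; simpl; ring.
Qed.

Lemma geom_mean_conj (w : nat -> C) :
  geom_mean n (fun k => Cconj (w k)) = Cconj (geom_mean n w).
Proof.
unfold geom_mean.
assert (E : sum_n_m (fun k => Cln (Cconj (w k))) 1 n = Cconj (sum_n_m (fun k => Cln (w k)) 1 n)).
{ apply C_eq; rewrite ?re_conj, ?im_conj, ?Re_sum_n_m, ?Im_sum_n_m.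
  - apply sum_n_m_ext; intros k; rewrite Cln_conj; apply re_conj.
  - match goal with |- _ = - ?u => replace (- u) with (- (1) * u) by ring end.
    apply sum_n_m_factor_l; intros k _; rewrite Cln_conj, im_conj; ring. }
rewrite E; unfold Cexp; rewrite !re_scal_l, !im_scal_l, re_conj, im_conj.
rewrite <- Ropp_mult_distr_r, cos_neg, sin_neg; apply C_eq; simpl; ring.
Qed.

Lemma geom_mean_lower (z : C) : Im z < 0 ->
  geom_mean n (fun k => RtoC (a k) + z)%C = representation z.
Proof.
intros H.
rewrite <- (Cconj_conj (representation z)), <- representation_conj by lra.
rewrite <- geom_mean_upper by (rewrite im_conj; lra).
rewrite <- geom_mean_conj; unfold geom_mean; do 2 f_equal.
apply sum_n_m_ext; intros k; f_equal.
rewrite Cplus_conj, Cconj_conj; f_equal; apply C_eq; simpl; ring.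
Qed.

(** * Real points to the right of the cut *)

Section RealPoint.
Variable x : R.
Hypothesis x_right : - a 1%nat < x.

Lemma slit_vertical y : ~ ray_le (- a 1%nat) (x, y).
Proof. intros [_ H]; simpl in H; lra. Qed.

Lemma continuous_vertical y : continuous (fun y : R => (x, y) : C) y.
Proof.
apply continuous_C; simpl; [apply continuous_const|apply continuous_id].
Qed.

(** On the vertical line through [x] the real part of [t + z] is at least [a 1 + x > 0], so the
    kernel has no singularity as [y] passes through 0. *)
Lemma continuous_kernel_2d t y : a 1%nat <= t ->
  continuous (fun q : R * R => kernel n a (x, snd q) (fst q)) (t, y).
Proof.
intros L.
assert (F := continuous_fst (U := R_UniformSpace) (V := R_UniformSpace) t y).
assert (S := continuous_snd (U := R_UniformSpace) (V := R_UniformSpace) t y).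
apply continuous_Cmult.
- apply continuous_C; simpl; [|apply continuous_const].
  apply (continuous_comp fst (root_weight n a)); [exact F|apply continuous_root_weight, hn].
- apply continuous_Cinv; [|apply (kernel_den_neq0 (a 1%nat)); [apply slit_vertical|exact L]].
  apply continuous_Cplus; apply continuous_C; simpl; try apply continuous_const; assumption.
Qed.

Lemma continuous_kernel_sum y : continuous (fun y => kernel_sum (x, y)) y.
Proof.
apply (continuous_Csum (fun l y => RtoC (sin (INR l * PI / INR n)) * kernel_RInt (x, y) l)%C).
intros l Hl; apply continuous_Cmult; [apply continuous_const|].
apply (continuous_ext (fun y => (RInt (fun t => Re (kernel n a (x, y) t)) (a l) (a (S l)),
                     RInt (fun t => Im (kernel n a (x, y) t)) (a l) (a (S l))))).
{ intros s; symmetry; apply kernel_RInt_pair; [apply slit_vertical|exact Hl]. }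
assert (L := a_mono l Hl).
assert (L1 := mono_le n a 1 l a_mono ltac:(lia) ltac:(lia) ltac:(lia)).
apply continuous_C; cbn [Re Im fst snd].
- apply (continuous_RInt_param (fun t y => Re (kernel n a (x, y) t))); [exact L| |].
  + intros t Ht; apply continuity_2d_pt_filterlim.
    change (continuous (fun q : R * R => Re (kernel n a (x, snd q) (fst q))) (t, y)).
    apply continuous_Re, continuous_kernel_2d; lra.
  + intros s; apply (ex_RInt_continuous (V := R_CompleteNormedModule)).
    rewrite Rmin_left by exact L; intros t Ht.
    apply continuous_Re, (continuous_kernel n a _ (a 1%nat)); [exact hn|apply slit_vertical|lra].
- apply (continuous_RInt_param (fun t y => Im (kernel n a (x, y) t))); [exact L| |].
  + intros t Ht; apply continuity_2d_pt_filterlim.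
    change (continuous (fun q : R * R => Im (kernel n a (x, snd q) (fst q))) (t, y)).
    apply continuous_Im, continuous_kernel_2d; lra.
  + intros s; apply (ex_RInt_continuous (V := R_CompleteNormedModule)).
    rewrite Rmin_left by exact L; intros t Ht.
    apply continuous_Im, (continuous_kernel n a _ (a 1%nat)); [exact hn|apply slit_vertical|lra].
Qed.

(** The disc argument is centred at an interior point of the half-plane and says nothing at [y = 0].
    Both sides are continuous along the vertical line, where every [a_k + x + i y] stays off the
    cut, and they agree for [y > 0]. *)
Lemma geom_mean_real :
  geom_mean n (fun k => RtoC (a k) + (x, 0))%C = representation (x, 0).
Proof.
set (D := fun y => (geom_mean n (fun k => RtoC (a k) + (x, y)) - representation (x, y))%C).
assert (C0 : continuous D 0).
{ apply continuous_Cminus.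
  - apply continuous_Cexp, continuous_Cmult; [apply continuous_const|].
    apply (continuous_Csum (fun k y => Cln (RtoC (a k) + (x, y))%C)); intros k Hk.
    apply continuous_Cln.
    + apply continuous_Cplus; [apply continuous_const|apply continuous_vertical].
    + intros [_ H]; simpl in H.
      assert (L := mono_le n a 1 k a_mono ltac:(lia) ltac:(lia) ltac:(lia)); lra.
  - apply continuous_Cminus.
    + apply continuous_Cplus; [apply continuous_const|apply continuous_vertical].
    + apply continuous_Cmult; [apply continuous_const|apply continuous_kernel_sum]. }
assert (Z : Cmod (D 0) = 0).
{ apply (continuous_right_zero (fun y => Cmod (D y))); [apply continuous_Cmod, C0|].
  intros s Hs; unfold D; rewrite geom_mean_upper by exact Hs.
  unfold Cminus; rewrite Cplus_opp_r; apply Cmod_0. }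
apply Cmod_eq_0 in Z.
rewrite <- (Cplus_0_l (representation (x, 0))), <- Z; unfold D; ring.
Qed.
End RealPoint.

Lemma geom_mean_representation (z : C) : ~ ray_le (- a 1%nat) z ->
  geom_mean n (fun k => RtoC (a k) + z)%C = representation z.
Proof.
intros Hz; destruct (Rtotal_order (Im z) 0) as [H|[H|H]].
- apply geom_mean_lower, H.
- destruct z as [x y]; simpl in H; subst y; apply geom_mean_real.
  apply Rnot_le_lt; intros L; apply Hz; split; [reflexivity|exact L].
- apply geom_mean_upper, H.
Qed.
End Formula.

Theorem theorem3p1 (n : nat) (a : nat -> R) (z : C)
  (hn : (1 <= n)%nat)
  (ha_pos : 0 < a 1%nat)
  (ha_mono : forall k : nat, (1 <= k <= n - 1)%nat -> a k <= a (S k))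
  (hz : ~ ray_le (- a 1%nat) z) :
  geom_mean n (fun k => RtoC (a k) + z)%C =
  (RtoC (arith_mean n a) + z
   - RtoC (/ PI) *
     sum_n_m (fun l =>
        RtoC (sin (INR l * PI / INR n)) *
        RInt (V := C_R_CompleteNormedModule)
          (fun t : R =>
             RtoC (nroot n (Rabs (prod_n_m (fun k => (a k - t)%R) 1 n)))
             / (RtoC t + z))
          (a l) (a (S l)))
       1 (n - 1))%C.
Proof.
exact (geom_mean_representation n a hn ha_mono z hz).
Qed.
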